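(* Let $V_a$, $\{V_{a_i}\}_{i\in\mathbb{N}}$, $\{R_i\}_{i\in\mathbb{N}}$ be a space splitting as in the context: $\mathrm{span}(\{R_iV_{a_i}\}_{i\in\mathbb{N}})$ is dense in $V_a$, and for some constant $\Lambda$ one has $\|R_iv_i\|_a\le \Lambda\|v_i\|_{a_i}$ for all $v_i\in V_{a_i}$, $i\in\mathbb{N}$. Let $u\in V_a$ be the solution of the variational problem $a(u,v)=F(v)$ for all $v\in V$ (no further assumption on $u$). Let $u^{(m)}$, $m\ge 0$, be the iterates of the Schwarz iterative method described in the context, with $u^{(0)}=0$, $\alpha_m=1-(m+2)^{-1}$, and $\omega_m$ given by exact error minimization. a) (Greedy ordering.) Let $\beta\in(0,1]$ and assume that for every $m\ge 0$ the index $i_m\in\mathbb{N}$ satisfies $$a_{i_m}(r^{(m)}_{i_m},r^{(m)}_{i_m})\ge \beta^2\sup_{i\in\mathbb{N}}a_i(r^{(m)}_i,r^{(m)}_i),\qquad r^{(m)}_i:=T_i(u-u^{(m)}).$$ Then $u^{(m)}\to u$ in $V_a$ as $m\to\infty$. More precisely, for any $h\in\mathcal{A}_1$, $$\|u-u^{(m)}\|_a\le 2\|u-h\|_a+\frac{\sqrt{8\left(\|u\|_a^2+(\Lambda/\beta)^2\|h\|_{\mathcal{A}_1}^2\right)}}{(m+1)^{1/2}},\qquad m\ge 0.$$ b) (Random ordering.) Assume that the indices $i_m\in\mathbb{N}$, $m\ge 0$, are chosen randomly and independently according to a fixed discrete probability distribution $\pi=\{\pi_i\}_{i\in\mathbb{N}}$.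 Then for any $h\in\mathcal{A}^\pi_\infty$, $$E(\|u-u^{(m)}\|_a^2)^{1/2}\le 2\|u-h\|_a+\frac{\sqrt{8\left(\|u\|_a^2+\Lambda^2\|h\|_{\mathcal{A}^\pi_\infty}^2\right)}}{(m+1)^{1/2}},\qquad m\ge 0.$$ Moreover, if $\pi_i>0$ for all $i\in\mathbb{N}$, then $E(\|u-u^{(m)}\|_a^2)\to 0$ as $m\to\infty$.
   Context: **Setting.** $V$ is a separable real or complex Hilbert space, $a(\cdot,\cdot)$ is a continuous coercive Hermitian form on $V$, and $V_a$ denotes $V$ equipped with the (equivalent) scalar product $a$ and norm $\|v\|_a=a(v,v)^{1/2}$. Hermitian forms are linear in the first argument. $F$ is a bounded linear functional on $V$ (conjugate-linear in the complex case), so that the problem ''find $u\in V$ with $a(u,v)=F(v)$ for all $v\in V$'' has a unique solution. For each $i\in\mathbb{N}$, $V_{a_i}$ is a Hilbert space with scalar product $a_i(\cdot,\cdot)$ and norm $\|\cdot\|_{a_i}$, and $R_i:V_{a_i}\to V_a$ is a bounded linear operator. No stability of the splitting is assumed. **Operators $T_i$.** $T_i:V_a\to V_{a_i}$ is defined by $a_i(T_iv,v_i)=a(v,R_iv_i)$ for all $v_i\in V_{a_i}$. **Schwarz iterative method.** Given $u^{(m)}$, an index $i=i_m\in\mathbb{N}$ is picked (by the rule specified in the claim), one computes $r_i^{(m)}=T_i(u-u^{(m)})$ and sets $$u^{(m+1)}=\alpha_mu^{(m)}+\omega_mR_ir_i^{(m)},\qquad \alpha_m=1-(m+2)^{-1},\qquad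 \omega_m=\frac{a(u-\alpha_mu^{(m)},R_ir_i^{(m)})}{\|R_ir_i^{(m)}\|_a^2},$$ i.e. $\omega_m$ is the minimizer of $\omega\mapsto\|u-\alpha_mu^{(m)}-\omega R_ir_i^{(m)}\|_a$ over scalars $\omega$. If $R_ir_i^{(m)}=0$, the value of $\omega_m$ is irrelevant and $u^{(m+1)}=\alpha_mu^{(m)}$. **Approximation spaces.** A discrete probability distribution is a sequence $\pi=\{\pi_i\}_{i\in\mathbb{N}}$ with $\pi_i\ge0$, $\sum_i\pi_i=1$; $\mathrm{supp}(\pi)=\{i:\pi_i>0\}$. For a non-negative weight sequence $\gamma=\{\gamma_i\}_{i\in\mathbb{N}}$ and $0<q\le\infty$, define for $u\in\mathrm{span}(\{R_iV_{a_i}\}_{i\in\mathrm{supp}(\gamma)})$ $$\|u\|_{\mathcal{A}^\gamma_q}=\inf\left\{\big\|\{\gamma_i^{-1}\|v_i\|_{a_i}\}_{i\in I}\big\|_{\ell^q}:\ u=\sum_{i\in I}R_iv_i,\ v_i\in V_{a_i},\ I\subset\mathrm{supp}(\gamma)\text{ finite}\right\},$$ and let $\mathcal{A}^\gamma_q$ be the completion with respect to this (quasi-)norm. $\mathcal{A}_q$ denotes the case $\gamma_i=1$ for all $i$. For $\mathcal{A}_1$ and $\mathcal{A}_\infty^\pi$ one has $\|\cdot\|_a\le\Lambda\|\cdot\|_{\mathcal{A}}$ on finite sums, and elements of these completions are regarded as elements of $V_a$ via the continuous extension of the inclusion of the span into $V_a$. *)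

(* Defs.v *)
From HB Require Import structures.
From mathcomp Require Import all_boot all_order all_algebra finmap.
From mathcomp Require Import all_classical all_reals all_analysis.
From mathcomp Require Import complex.

Set Implicit Arguments.
Unset Strict Implicit.
Unset Printing Implicit Defensive.

Import Order.TTheory GRing.Theory Num.Theory.
Import numFieldNormedType.Exports.

Local Open Scope classical_set_scope.
Local Open Scope ring_scope.

Variant scalar_kind := RealScalars | ComplexScalars.

Definition scalar_field (R : realType) (k : scalar_kind) : numFieldType :=
  match k with RealScalars => R | ComplexScalars => R[i] end.

Definition scalar_conj (R : realType) (k : scalar_kind) :
    {rmorphism scalar_field R k -> scalar_field R k} :=
  match k with
  | RealScalars => idfun
  | ComplexScalars => @conjc R
  end.

Definition scalar_re (R : realType) (k : scalar_kind) : scalar_field R k -> R :=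
  match k with
  | RealScalars => fun x => x
  | ComplexScalars => @complex.Re R
  end.

(* The forms {dot _ for theta} and {hermitian _ for false & theta} are linear
   in the first argument and theta-linear in the second one. *)
Record hilbertType (R : realType) (k : scalar_kind) := HilbertType {
  hilbert_sort :> completeNormedModType (scalar_field R k);
  hdot : {dot hilbert_sort for scalar_conj R k};
  hdot_normE : forall x : hilbert_sort, `|x| ^+ 2 = hdot x x
}.

Definition separable (T : topologicalType) : Prop :=
  exists2 D : set T, countable D & dense D.

Section EnergyForm.
Context {R : realType} {k : scalar_kind}.
Local Notation K := (scalar_field R k).
Variable V : hilbertType R k.

Definition coercive (a : V -> V -> K) : Prop :=
  exists2 c : K, 0 < c & forall v, c * `|v| ^+ 2 <= a v v.

Definition bounded_functional (F : V -> K) : Prop :=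
  exists C : K, forall v, `|F v| <= C * `|v|.

(* a(v,v) is real for a Hermitian form, so that scalar_re only changes its
   type from scalar_field R k to R. *)
Definition sqnorm (a : V -> V -> K) (v : V) : R := scalar_re (a v v).

Definition fnorm (a : V -> V -> K) (v : V) : R := Num.sqrt (sqnorm a v).

End EnergyForm.

Section Splitting.
Context {R : realType} {k : scalar_kind}.
Local Notation K := (scalar_field R k).
Variables (V : hilbertType R k) (a : {hermitian V for false & scalar_conj R k}).
Variables (W : nat -> hilbertType R k) (Rop : forall i, {linear W i -> V}).

(* The Riesz representative of the functional w |-> a(v, R_i w) on W i. *)
Definition Top (i : nat) (v : V) : W i :=
  xget 0 [set t : W i | forall w : W i, hdot (W i) t w = a v (Rop i w)].

(* If g = 0, then omega = 0 because x / 0 = 0. *)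
Definition schwarz_step (u : V) (m i : nat) (um : V) : V :=
  let alpha : K := 1 - m.+2%:R^-1 in
  let g := Rop i (Top i (u - um)) in
  let omega : K := a (u - alpha *: um) g / a g g in
  alpha *: um + omega *: g.

Fixpoint schwarz (u : V) (idx : nat -> nat) (m : nat) : V :=
  if m is n.+1 then schwarz_step u n (idx n) (schwarz u idx n) else 0.

Definition greedy (u : V) (beta : R) (idx : nat -> nat) : Prop :=
  forall m,
    let r (i : nat) := Top i (u - schwarz u idx m) in
    beta ^+ 2 * sup (range (fun i => sqnorm (hdot (W i)) (r i)))
      <= sqnorm (hdot (W (idx m))) (r (idx m)).

Definition decomposition (J : set nat) (v : V)
    (I : {fset nat}) (w : forall i, W i) : Prop :=
  (forall i, i \in I -> J i) /\ v = \sum_(i <- I) Rop i (w i).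

Definition split_span (J : set nat) : set V :=
  [set v | exists I w, decomposition J v I w].

Definition fnorm_dense (A : set V) : Prop :=
  forall v (e : R), 0 < e -> exists2 w, A w & fnorm a (v - w) < e.

Definition wsupp (gamma : nat -> R) : set nat := [set i | 0 < gamma i].

(* Only meant for 0 < q; the value at -oo is junk. *)
Definition lq_norm (q : \bar R) (I : {fset nat}) (x : nat -> R) : R :=
  match q with
  | p%:E => (\sum_(i <- I) `|x i| `^ p) `^ p^-1
  | +oo%E => \big[Num.max/0]_(i <- I) `|x i|
  | -oo%E => 0
  end.

Definition span_norm (gamma : nat -> R) (q : \bar R) (v : V) : R :=
  inf [set x | exists I w, decomposition (wsupp gamma) v I w /\
    x = lq_norm q I (fun i => (gamma i)^-1 * fnorm (hdot (W i)) (w i))].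

(* The completion of the span with respect to span_norm, by Cauchy sequences.
   Equivalent sequences are not identified: completion_norm and completion_val
   take the same value on them. The map completion_val need not be injective
   on the completion, hence the norm is a function of the sequence and not of
   its limit in V. *)
Record completion (gamma : nat -> R) (q : \bar R) := Completion {
  cseq :> nat -> V;
  cseq_span : forall n, split_span (wsupp gamma) (cseq n);
  cseq_cauchy : forall e : R, 0 < e -> exists N, forall m n,
    (N <= m)%N -> (N <= n)%N -> span_norm gamma q (cseq m - cseq n) < e
}.

Definition completion_norm gamma q (h : completion gamma q) : R :=
  lim (span_norm gamma q (h n) @[n --> \oo]).

(* Continuous extension of the inclusion of the span into V_a. *)
Definition completion_val gamma q (h : completion gamma q) : V :=
  xget 0 [set v : V | fnorm a (h n - v) @[n --> \oo] --> (0 : R)].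

End Splitting.

Arguments span_norm {R k V W} Rop gamma q v.
Arguments completion {R k V W} Rop gamma q.

Definition discrete_distribution (R : realType) (p : nat -> R) : Prop :=
  (forall i, 0 <= p i) /\ (\sum_(0 <= i <oo) (p i)%:E = 1)%E.

Definition mutually_independent (R : realType) (d d' : measure_display)
    (T : measurableType d) (T' : measurableType d') (P : probability T R)
    (X : nat -> {RV P >-> T'}) : Prop :=
  forall (J : {fset nat}) (A : nat -> set T'), (forall m, measurable (A m)) ->
    P (\bigcap_(m in [set` J]) (X m @^-1` A m))
      = (\prod_(m <- J) P (X m @^-1` A m))%E.

(* Main.v *)
Require Import Defs.
From HB Require Import structures.
From mathcomp Require Import all_boot all_order all_algebra finmap.
From mathcomp Require Import all_classical all_reals all_analysis.
From mathcomp Require Import measurable_realfun complex ring lra.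

Import Order.TTheory GRing.Theory Num.Theory.
Import numFieldNormedType.Exports.

Local Open Scope classical_set_scope.
Local Open Scope ring_scope.

(** The real part of a Hermitian form is a real inner product, so the argument
    is real. Comparing the optimal step with a step of size [t / ((m + 2) |T_i e|)]
    gives, for the error [e] of [u^(m)] and [C := 2 (|u|^2 + Lambda^2 t^2)],
    [(m+2)^2 |e'|^2 <= (m+1)^2 |e|^2 + 2 (m+1) (a(e,u) - t |T_i e|) + C].
    A decomposition of [h] bounds [a(e,h)] by [|h|] times a functional [S e],
    equal to [sup_i |T_i e|] for A_1 and to [sum_i p_i |T_i e|] for A_oo^p, and
    this inequality passes to the completion. With [t] proportional to [|h|],
    the greedy choice, respectively the mean over the independent index, makes
    [t |T_i e|] absorb [a(e,h)]. Hence, with [D := |u - h|],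
    [(m+2)^2 |e'|^2 <= (m+1)^2 |e|^2 + 2 (m+1) D |e| + C], whose solutions satisfy
    [|e| <= D + sqrt (C / (m+1))]; this is slightly stronger than the claim. *)

(** * Real and complex scalars treated uniformly *)

Section Scalars.
Variables (R : realType) (k : scalar_kind).
Local Notation K := (scalar_field R k).
Local Notation re := (@scalar_re R k).

(** The embedding of the reals, by which real factors scale vectors over either field. *)
Definition scalar_of : {rmorphism R -> K} :=
  match k with
  | RealScalars => idfun
  | ComplexScalars => real_complex R
  end.

Lemma scalar_reD (x y : K) : re (x + y) = re x + re y.
Proof. by move: x y; case: k => // -[a b] [c d]. Qed.

Lemma scalar_reN (x : K) : re (- x) = - re x.
Proof. by move: x; case: k => // -[a b]. Qed.

Lemma scalar_re0 : re 0 = 0.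
Proof. by case: k. Qed.

Lemma scalar_re_conj (x : K) : re (scalar_conj R k x) = re x.
Proof. by move: x; case: k => // -[a b]. Qed.

Lemma scalar_re_ofM (t : R) (x : K) : re (scalar_of t * x) = t * re x.
Proof.
rewrite /scalar_of; move: x; case: k => // -[a b] /=.
by rewrite mul0r subr0.
Qed.

Lemma scalar_conj_of (t : R) : scalar_conj R k (scalar_of t) = scalar_of t.
Proof. by rewrite /scalar_of; case: k => //=; rewrite oppr0. Qed.

Lemma scalar_ofK (t : R) : re (scalar_of t) = t.
Proof. by rewrite -[scalar_of t]mulr1 scalar_re_ofM; case: k; rewrite mulr1. Qed.

Lemma scalar_of_re (x : K) : 0 <= x -> scalar_of (re x) = x.
Proof.
rewrite /scalar_of; move: x; case: k => // -[a b].
by rewrite lecE /= => /andP[/eqP -> _].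
Qed.

Lemma scalar_re_le (x y : K) : x <= y -> re x <= re y.
Proof.
move: x y; case: k => // -[a b] [c d].
by rewrite lecE /= => /andP[].
Qed.

Lemma scalar_re_lt (x y : K) : x < y -> re x < re y.
Proof.
move: x y; case: k => // -[a b] [c d].
by rewrite ltcE /= => /andP[].
Qed.

Lemma scalar_of_gt0 (t : R) : 0 < t -> 0 < scalar_of t.
Proof. by rewrite /scalar_of; case: k => //= t0; rewrite ltcE /= eqxx. Qed.

(** The factor 1 tests the real part and the imaginary unit the imaginary part. This recovers a
    scalar identity from identities between real parts. *)
Lemma scalar_re_mul_eq0 (z : K) : (forall c : K, re (c * z) = 0) -> z = 0.
Proof.
move: z; case: k => [z /(_ 1)|[a b] h] /=; first by rewrite mul1r.
have /= := h 1%C; have /= := h 'i%C.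
rewrite !mul0r !mul1r !subr0 sub0r => /eqP; rewrite oppr_eq0 => /eqP -> ->.
by [].
Qed.

Lemma scalar_re_le_norm (z : K) : re z <= re `|z|.
Proof.
move: z; case: k => [z|[a b]] /=; first exact: ler_norm.
by rewrite (le_trans (ler_norm a))// -sqrtr_sqr ler_sqrt ?addr_ge0 ?sqr_ge0// lerDl sqr_ge0.
Qed.

End Scalars.

(** * The real inner product carried by a Hermitian form *)

Section RealForm.
Context {R : realType} {k : scalar_kind} {V : hilbertType R k}.
Variable b : {hermitian V for false & scalar_conj R k}.
Implicit Types x y z : V.

Definition reform x y : R := scalar_re (b x y).

Lemma reformC x y : reform x y = reform y x.
Proof. by rewrite /reform hermC expr0 mul1r scalar_re_conj. Qed.

Lemma reformDr x y z : reform x (y + z) = reform x y + reform x z.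
Proof. by rewrite /reform linearDr scalar_reD. Qed.

Lemma reformDl x y z : reform (y + z) x = reform y x + reform z x.
Proof. by rewrite reformC reformDr !(reformC x). Qed.

Lemma reformNr x y : reform x (- y) = - reform x y.
Proof. by rewrite /reform linearNr scalar_reN. Qed.

Lemma reformNl x y : reform (- y) x = - reform y x.
Proof. by rewrite reformC reformNr reformC. Qed.

Lemma reformBr x y z : reform x (y - z) = reform x y - reform x z.
Proof. by rewrite reformDr reformNr. Qed.

Lemma reformBl x y z : reform (y - z) x = reform y x - reform z x.
Proof. by rewrite reformDl reformNl. Qed.

Lemma reform0r x : reform x 0 = 0.
Proof. by rewrite /reform linear0r scalar_re0. Qed.

Lemma reformZr t x y : reform x (scalar_of R k t *: y) = t * reform x y.
Proof. by rewrite /reform linearZr_LR /= scalar_conj_of scalar_re_ofM. Qed.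

Lemma reformZl t x y : reform (scalar_of R k t *: y) x = t * reform y x.
Proof. by rewrite reformC reformZr reformC. Qed.

Lemma reform_sumr x (I : Type) (r : seq I) (f : I -> V) :
  reform x (\sum_(i <- r) f i) = \sum_(i <- r) reform x (f i).
Proof.
by elim/big_ind2 : _ => [|? ? ? ? <- <-|//]; rewrite ?reform0r ?reformDr.
Qed.

Lemma sqnormE x : sqnorm b x = reform x x. Proof. by []. Qed.

Lemma sqnorm0 : sqnorm b 0 = 0.
Proof. exact: reform0r. Qed.

Lemma sqnormN x : sqnorm b (- x) = sqnorm b x.
Proof. by rewrite !sqnormE reformNr reformNl opprK. Qed.

Lemma sqnormD x y : sqnorm b (x + y) = sqnorm b x + 2 * reform x y + sqnorm b y.
Proof. rewrite !sqnormE reformDr !reformDl (reformC y x); ring. Qed.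

Lemma sqnormB x y : sqnorm b (x - y) = sqnorm b x - 2 * reform x y + sqnorm b y.
Proof. by rewrite sqnormD sqnormN reformNr mulrN. Qed.

Lemma sqnormZ t x : sqnorm b (scalar_of R k t *: x) = t ^+ 2 * sqnorm b x.
Proof. rewrite !sqnormE reformZl reformZr; ring. Qed.

Lemma fnorm_ge0 x : 0 <= fnorm b x. Proof. exact: sqrtr_ge0. Qed.

Lemma fnorm0 : fnorm b 0 = 0.
Proof. by rewrite /fnorm sqnorm0 sqrtr0. Qed.

Lemma fnormN x : fnorm b (- x) = fnorm b x.
Proof. by rewrite /fnorm sqnormN. Qed.

Lemma fnormBC x y : fnorm b (x - y) = fnorm b (y - x).
Proof. by rewrite -fnormN opprB. Qed.

Hypothesis b_ge0 : forall x, 0 <= sqnorm b x.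

Lemma sqr_fnorm x : fnorm b x ^+ 2 = sqnorm b x.
Proof. exact: sqr_sqrtr. Qed.

(** Cauchy-Schwarz for a possibly degenerate form, from |t x - y|^2 >= 0 for all real t. *)
Lemma reform_le x y : reform x y <= fnorm b x * fnorm b y.
Proof.
have [xy0|xy0] := leP (reform x y) 0.
  by rewrite (le_trans xy0)// mulr_ge0 ?fnorm_ge0.
rewrite -(ler_pXn2r (n := 2)) ?nnegrE ?(ltW xy0) ?mulr_ge0 ?fnorm_ge0//.
rewrite exprMn !sqr_fnorm.
set p := reform x y; set X := sqnorm b x; set Y := sqnorm b y.
have q t : 0 <= t ^+ 2 * X - 2 * t * p + Y.
  by have := b_ge0 (scalar_of R k t *: x - y); rewrite sqnormB sqnormZ reformZl mulrA.
have [X0|X0] := eqVneq X 0.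
  (* For X = 0 the quadratic is affine in t, and at this t its value is -1. *)
  have := q ((Y + 1) / (2 * p)); rewrite X0 mulr0 add0r.
  have -> : 2 * ((Y + 1) / (2 * p)) * p = Y + 1 by field; rewrite gt_eqF.
  lra.
have Xp : 0 < X by rewrite lt_def X0 b_ge0.
(* The minimizer of the quadratic. *)
have := q (p / X).
have -> : (p / X) ^+ 2 * X - 2 * (p / X) * p + Y = (X * Y - p ^+ 2) / X by field.
by rewrite pmulr_lge0 ?invr_gt0// subr_ge0.
Qed.

Lemma fnormD x y : fnorm b (x + y) <= fnorm b x + fnorm b y.
Proof.
rewrite -(ler_pXn2r (n := 2)) ?nnegrE ?addr_ge0 ?fnorm_ge0//.
rewrite sqr_fnorm sqnormD sqrrD !sqr_fnorm mulr2n.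
by have := reform_le x y; lra.
Qed.

Lemma sqnormD_le x y : sqnorm b (x + y) <= 2 * (sqnorm b x + sqnorm b y).
Proof. by have := b_ge0 (x - y); rewrite sqnormB sqnormD; lra. Qed.

End RealForm.

(** * Norm and completeness of a Hilbert space in real terms *)

Section Hilbert.
Context {R : realType} {k : scalar_kind}.
Variable V : hilbertType R k.
Implicit Types x y z : V.
Local Notation hd := (hdot V).

Lemma hdot_sqnorm_ge0 x : 0 <= sqnorm hd x.
Proof.
rewrite -(scalar_re0 R k); apply: scalar_re_le.
by rewrite -hdot_normE exprn_ge0.
Qed.

Lemma hdot_fnormE x : `|x| = scalar_of R k (fnorm hd x).
Proof.
have h : scalar_of R k (sqnorm hd x) = `|x| ^+ 2.
  by rewrite /sqnorm scalar_of_re -?hdot_normE// exprn_ge0.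
apply/eqP; rewrite -(eqrXn2 (n := 2))//; last first.
  have := fnorm_ge0 hd x; rewrite le_eqVlt => /orP[/eqP <-|/(scalar_of_gt0 R k)/ltW//].
  by rewrite rmorph0.
by rewrite -rmorphXn /= sqr_fnorm ?h//; exact: hdot_sqnorm_ge0.
Qed.

Lemma hdot_fnorm_lt x (e : R) : (`|x| < scalar_of R k e) = (fnorm hd x < e).
Proof.
apply/idP/idP => [/scalar_re_lt|h].
  by rewrite hdot_fnormE !scalar_ofK.
by rewrite hdot_fnormE -subr_gt0 -rmorphB scalar_of_gt0// subr_gt0.
Qed.

Lemma hilbert_complete (s : nat -> V) :
  (forall e : R, 0 < e -> exists N, forall m n, (N <= m)%N -> (N <= n)%N ->
     fnorm hd (s m - s n) < e) ->
  exists l : V, forall e : R, 0 < e -> \forall n \near \oo, fnorm hd (s n - l) < e.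
Proof.
move=> sC.
have scvg : cvg (s @ \oo).
  apply/cauchy_cvgP/cauchy_ballP => e e0.
  have re0 : 0 < scalar_re e by rewrite -(scalar_re0 R k) scalar_re_lt.
  have [N NP] := sC _ re0.
  pose A := s @` [set n | (N <= n)%N].
  exists (A, A) => /=; first by split; exists N => // n Nn; exists n.
  move=> [_ _] /= [[m Nm <-] [n Nn <-]].
  by rewrite -ball_normE /ball_ /= -(scalar_of_re R k e (ltW e0)) hdot_fnorm_lt NP.
exists (lim (s @ \oo)) => e e0.
have /cvgrPdist_lt/(_ _ (scalar_of_gt0 R k _ e0)) := scvg.
by apply: filterS => n; rewrite distrC hdot_fnorm_lt.
Qed.

End Hilbert.

(** * Conjugation, and Riesz representation of real-valued functionals *)

Lemma scalar_conjK (R : realType) (k : scalar_kind) :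
  involutive (scalar_conj R k).
Proof. by case: k => //= -[a b] /=; rewrite opprK. Qed.

(* The representative is the limit of a minimizing sequence of
   [w |-> |w|^2 - 2 f w]. *)
Lemma real_riesz (R : realType) (k : scalar_kind) (W : hilbertType R k)
    (f : W -> R) (M : R) :
  {morph f : x y / x + y} ->
  (forall t x, f (scalar_of R k t *: x) = t * f x) ->
  (forall x, f x <= M * fnorm (hdot W) x) ->
  exists t : W, forall w, reform (hdot W) t w = f w.
Proof.
move=> fD fZ fM.
set hd := hdot W; have hd0 := hdot_sqnorm_ge0 W : forall x, 0 <= sqnorm hd x.
pose J w := sqnorm hd w - 2 * f w.
have JE x y s : J (x + scalar_of R k s *: y) =
    J x + 2 * s * (reform hd x y - f y) + s ^+ 2 * sqnorm hd y.
  rewrite /J sqnormD fD fZ reformZr sqnormZ; ring.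
have Jinf : has_inf (range J).
  split; first by exists (J 0); exists 0.
  (* The lower bound comes from |w|^2 - 2 M |w| >= -M^2. *)
  exists (- M ^+ 2) => _ [w _ <-]; rewrite /J -(sqr_fnorm hd hd0).
  have := fM w; have := sqr_ge0 (fnorm hd w - M); rewrite /hd sqrrB; lra.
set j := inf (range J).
have jJ w : j <= J w by apply: ge_inf; [exact: Jinf.2|exists w].
have mins n : exists w, J w < j + n.+1%:R^-1.
  have n0 : 0 < (n.+1%:R^-1 : R) by rewrite invr_gt0 ltr0n.
  by have [_ [w _ <-] ?] := inf_adherent n0 Jinf; exists w.
have [s sP] := choice mins.
have sC m n : sqnorm hd (s m - s n) < 2 * (m.+1%:R^-1 + n.+1%:R^-1).
  (* By the parallelogram law the value of [J] at the midpoint is the mean of the two values minus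
     |s m - s n|^2 / 4; it is at least [j]. *)
  pose c := s m + scalar_of R k 2^-1 *: (s n - s m).
  have : J c = (J (s m) + J (s n)) / 2 - sqnorm hd (s m - s n) / 4.
    have -> : J (s n) = J (s m + scalar_of R k 1 *: (s n - s m)).
      by rewrite rmorph1 scale1r addrC subrK.
    by rewrite /c !JE -(sqnormN hd (s m - s n)) opprB; field.
  have := jJ c; have := sP m; have := sP n.
  move: (m.+1%:R^-1) (n.+1%:R^-1) => p q; lra.
have sC' e : 0 < e -> exists N, forall m n, (N <= m)%N -> (N <= n)%N ->
    fnorm hd (s m - s n) < e.
  move=> e0; have e2 : 0 < e ^+ 2 / 4 by rewrite divr_gt0 ?exprn_gt0.
  have [N _ NP] := near_infty_natSinv_lt (PosNum e2).
  exists N => m n Nm Nn.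
  have hm : m.+1%:R^-1 < e ^+ 2 / 4 by exact: NP.
  have hn : n.+1%:R^-1 < e ^+ 2 / 4 by exact: NP.
  rewrite -(ltr_pXn2r (n := 2)) ?nnegrE ?fnorm_ge0 ?(ltW e0)//.
  rewrite sqr_fnorm//; move: hm hn (sC m n).
  by move: (m.+1%:R^-1) (n.+1%:R^-1) => p q; lra.
have [t tP] := hilbert_complete _ _ sC'.
exists t => w; apply/eqP; rewrite -subr_eq0; apply/eqP.
set D := (X in X = 0).
(* First-order optimality of the limit: [J] at s n + r w is at least [j], and s n is replaced by t
   up to an arbitrary error. *)
have key r : 0 <= 2 * r * D + r ^+ 2 * sqnorm hd w.
  apply/ler_addgt0Pr => e e0.
  have F0 : 0 <= 2 * `|r| * fnorm hd w by rewrite !mulr_ge0 ?fnorm_ge0.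
  set F := 2 * `|r| * fnorm hd w in F0 *.
  (* The added 1 keeps the denominator positive when F = 0. *)
  have d0 : 0 < e / (2 * (F + 1)) by rewrite divr_gt0 ?mulr_gt0 ?ltr_wpDl.
  have e20 : 0 < e / 2 by rewrite divr_gt0.
  have [n [n1 n2]] : exists n, fnorm hd (s n - t) < e / (2 * (F + 1)) /\
      n.+1%:R^-1 < e / 2.
    by have [n] := filter_ex (filterI (tP _ d0)
      (near_infty_natSinv_lt (PosNum e20))); exists n.
  have := jJ (s n + scalar_of R k r *: w); rewrite JE.
  have -> : reform hd (s n) w = reform hd (s n - t) w + reform hd t w.
    by rewrite reformBl subrK.
  have B : 2 * r * reform hd (s n - t) w <= F * fnorm hd (s n - t).
    have [r0|r0] := leP 0 r.
      have := reform_le hd hd0 (s n - t) w; rewrite /F ger0_norm// => h.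
      rewrite -!mulrA ler_pM2l// ler_wpM2l//; lra.
    have := reform_le hd hd0 (t - s n) w; rewrite /F ltr0_norm//.
    rewrite -(opprB (s n)) reformNl fnormN => h.
    rewrite -!mulrA ler_pM2l// mulNr -mulrN.
    suff : (- r) * (- reform hd (s n - t) w) <= - r * (fnorm hd (s n - t) * fnorm hd w).
      lra.
    by rewrite ler_wpM2l// oppr_ge0 ltW.
  have B2 : F * fnorm hd (s n - t) <= e / 2.
    have : F * fnorm hd (s n - t) <= F * (e / (2 * (F + 1))) by rewrite ler_wpM2l// ltW.
    move/le_trans; apply.
    have -> : F * (e / (2 * (F + 1))) = e / 2 - e / (2 * (F + 1)).
      by field; rewrite gt_eqF// ltr_wpDl.
    by rewrite gerBl ltW.
  move: n2 (sP n); move: (n.+1%:R^-1) => p n2.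
  have -> : reform hd (s n - t) w + reform hd t w - f w = reform hd (s n - t) w + D.
    by rewrite /D addrA.
  by move: B B2 n2; lra.
have S0 := hd0 w.
have [S00|Sn] := eqVneq (sqnorm hd w) 0.
  by have := key 1; have := key (-1); rewrite S00; lra.
(* The minimizing r: the minimum -D^2 / |w|^2 is nonnegative only if D = 0. *)
have := key (- D / sqnorm hd w).
have -> : 2 * (- D / sqnorm hd w) * D + (- D / sqnorm hd w) ^+ 2 * sqnorm hd w
   = - (D ^+ 2 / sqnorm hd w) by field.
rewrite oppr_ge0 pmulr_lle0 ?invr_gt0 ?lt_def ?Sn//.
by move=> h; apply/eqP; rewrite -sqrf_eq0 eq_le h sqr_ge0.
Qed.

(** * The operators T_i as adjoints of the R_i *)

Section Residuals.
Context {R : realType} {k : scalar_kind}.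
Variables (V : hilbertType R k) (a : {hermitian V for false & scalar_conj R k}).
Variables (W : nat -> hilbertType R k) (Rop : forall i, {linear W i -> V}).
Variable Lambda : R.
Hypothesis a_ge0 : forall v, 0 <= sqnorm a v.
Hypothesis Rop_bounded : forall (i : nat) (w : W i),
  fnorm a (Rop i w) <= Lambda * fnorm (hdot (W i)) w.

(** [Top] is a choice with default 0, so a representative has to be exhibited. [real_riesz]
    represents the real part, and scalar multiples of the test vector recover the rest. *)
Lemma TopP i v w : hdot (W i) (Top a Rop i v) w = a v (Rop i w).
Proof.
suff [t tP] : exists t : W i, forall w, hdot (W i) t w = a v (Rop i w).
  rewrite /Top; case: xgetP => [x _ -> //|none].
  by have := none t; case; exact: tP.
have [t tP] : exists t : W i, forall w,
    reform (hdot (W i)) t w = reform a v (Rop i w).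
  apply: (@real_riesz _ _ _ _ (fnorm a v * Lambda)) => [x y|s x|x].
  - by rewrite linearD reformDr.
  - by rewrite linearZ /= reformZr.
  - rewrite (le_trans (reform_le _ a_ge0 _ _))// -mulrA.
    by rewrite ler_wpM2l ?fnorm_ge0.
exists t => x; apply/eqP; rewrite -subr_eq0; apply/eqP/scalar_re_mul_eq0 => c.
(* Both forms are conjugate-linear in the second argument, so this multiple brings out the factor
   c. *)
have := tP (scalar_conj R k c *: x).
rewrite /reform [Rop i _]linearZ /= !linearZr_LR /= scalar_conjK => h.
by rewrite mulrBr scalar_reD scalar_reN h subrr.
Qed.

Definition resnorm i v : R := fnorm (hdot (W i)) (Top a Rop i v).

Lemma resnorm_ge0 i v : 0 <= resnorm i v. Proof. exact: fnorm_ge0. Qed.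

Lemma reform_Rop i v w : reform a v (Rop i w) = reform (hdot (W i)) (Top a Rop i v) w.
Proof. by rewrite /reform -TopP. Qed.

Lemma reform_Rop_le i v w :
  reform a v (Rop i w) <= resnorm i v * fnorm (hdot (W i)) w.
Proof. by rewrite reform_Rop reform_le//; exact: hdot_sqnorm_ge0. Qed.

Lemma sqr_resnorm i v : resnorm i v ^+ 2 = reform a v (Rop i (Top a Rop i v)).
Proof. by rewrite reform_Rop sqr_fnorm//; exact: hdot_sqnorm_ge0. Qed.

Lemma sqnorm_Rop_le i w :
  sqnorm a (Rop i w) <= Lambda ^+ 2 * sqnorm (hdot (W i)) w.
Proof.
rewrite -!sqr_fnorm//; last exact: hdot_sqnorm_ge0.
by rewrite -exprMn ler_pXn2r ?nnegrE ?fnorm_ge0// (le_trans (fnorm_ge0 _ _) (Rop_bounded _ _)).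
Qed.

(** The adjoint of R_i inherits its bound. The sign of [Lambda] is not prescribed, hence the
    absolute value. *)
Lemma resnorm_le i v : resnorm i v <= `|Lambda| * fnorm a v.
Proof.
have [->|r0] := eqVneq (resnorm i v) 0; first by rewrite mulr_ge0 ?fnorm_ge0.
have {}r0 : 0 < resnorm i v by rewrite lt_def r0 resnorm_ge0.
rewrite -(ler_pM2r r0) -expr2 sqr_resnorm.
rewrite (le_trans (reform_le _ a_ge0 _ _))// (mulrC `|_|) -mulrA ler_wpM2l ?fnorm_ge0//.
by rewrite (le_trans (Rop_bounded _ _))// ler_wpM2r ?fnorm_ge0 ?ler_norm.
Qed.

End Residuals.

(** * One Schwarz step with exact error minimization *)

Section SchwarzStep.
Context {R : realType} {k : scalar_kind}.
Variables (V : hilbertType R k) (a : {hermitian V for false & scalar_conj R k}).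
Variables (W : nat -> hilbertType R k) (Rop : forall i, {linear W i -> V}).
Variable Lambda : R.
Hypothesis a_ge0 : forall v, 0 <= sqnorm a v.
Hypothesis a_definite : forall v, a v v = 0 -> v = 0.
Hypothesis Rop_bounded : forall (i : nat) (w : W i),
  fnorm a (Rop i w) <= Lambda * fnorm (hdot (W i)) w.
Local Notation resnorm := (resnorm V a W Rop).

(** Pythagoras: y is orthogonal to g, so any other multiple of g only adds the square of a norm. If
    a(g,g) = 0, then g = 0 and both sides agree. *)
Lemma sqnorm_proj_le (z g : V) (s : scalar_field R k) :
  sqnorm a (z - (a z g / a g g) *: g) <= sqnorm a (z - s *: g).
Proof.
have [g0|g0] := eqVneq (a g g) 0.
  by rewrite (a_definite _ g0) !scaler0.
set w := a z g / a g g; set y := z - w *: g.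
have yg : a y g = 0 by rewrite /y linearBl linearZl_LR /= /w divfK// subrr.
have -> : z - s *: g = y + (w - s) *: g.
  by rewrite /y scalerBl addrA subrK.
rewrite sqnormD /reform linearZr_LR /= yg mulr0 scalar_re0 mulr0 addr0.
by rewrite lerDl.
Qed.

(* Compare the optimal step with the step of size [t / ((m + 2) |T_i e|)]. *)
Lemma schwarz_step_le (u x : V) (m i : nat) (t : R) :
  m.+2%:R ^+ 2 * sqnorm a (u - schwarz_step a Rop u m i x) <=
  m.+1%:R ^+ 2 * sqnorm a (u - x)
  + 2 * m.+1%:R * (reform a (u - x) u - t * resnorm i (u - x))
  + 2 * (sqnorm a u + Lambda ^+ 2 * t ^+ 2).
Proof.
rewrite /schwarz_step; set e := u - x; set g := Rop i _; set al := 1 - _.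
pose c := t / resnorm i e.
have m2 : m.+2%:R != 0 :> R by rewrite pnatr_eq0.
have alE : al = scalar_of R k (1 - m.+2%:R^-1).
  by rewrite rmorphB rmorph1 fmorphV rmorph_nat.
rewrite opprD addrA.
apply: (@le_trans _ _ (m.+2%:R ^+ 2 *
    sqnorm a (u - al *: x - scalar_of R k (m.+2%:R^-1 * c) *: g))).
  by rewrite ler_wpM2l ?sqr_ge0// sqnorm_proj_le.
rewrite -sqnormZ.
(* As al = (m + 1) / (m + 2), the trial error times m + 2 is (m + 1) e + (u - c g). *)
have -> : scalar_of R k m.+2%:R *:
    (u - al *: x - scalar_of R k (m.+2%:R^-1 * c) *: g) =
    scalar_of R k m.+1%:R *: e + (u - scalar_of R k c *: g).
  rewrite !scalerBr !scalerA alE -!rmorphM /= mulrA divff// mul1r mulrBr divff//.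
  rewrite mulr1 addrA; congr (_ - _).
  have -> : m.+2%:R - 1 = m.+1%:R :> R by rewrite -[m.+2%:R]natr1 addrK.
  by rewrite -[m.+2%:R]natr1 rmorphD rmorph1 scalerDl scale1r addrAC.
rewrite sqnormD sqnormZ reformZl reformBr reformZr -(sqr_resnorm _ _ _ _ Lambda)//.
(* A zero residual makes both sides vanish, so the division in c does no harm. *)
have cr : c * resnorm i e ^+ 2 = t * resnorm i e.
  rewrite /c; have [->|r0] := eqVneq (resnorm i e) 0; first by rewrite expr0n /= !mulr0.
  by field.
rewrite cr mulrA lerD2l.
(* Here |u - c g|^2 <= 2 (|u|^2 + c^2 |g|^2), and |g| <= Lambda |T_i e| bounds c^2 |g|^2 by Lambda^2
   t^2. *)
rewrite (le_trans (sqnormD_le a a_ge0 _ _))// ler_pM2l// lerD2l sqnormN sqnormZ.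
have := sqnorm_Rop_le V a W Rop Lambda a_ge0 Rop_bounded i (Top a Rop i e).
rewrite -/g -(sqr_fnorm _ (hdot_sqnorm_ge0 (W i))) -/(resnorm i e) => hg.
apply: (@le_trans _ _ (c ^+ 2 * (Lambda ^+ 2 * resnorm i e ^+ 2))).
  by rewrite ler_wpM2l ?sqr_ge0.
rewrite mulrCA ler_wpM2l ?sqr_ge0// /c.
have [->|r0] := eqVneq (resnorm i e) 0; first by rewrite expr0n /= mulr0 sqr_ge0.
by rewrite -exprMn divfK.
Qed.

End SchwarzStep.

(** * Finite l^q norms for q = 1 and q = oo *)

Section SumsOverFsets.
Variable R : realType.

Lemma lq_norm1 (I : {fset nat}) (x : nat -> R) :
  lq_norm 1%:E I x = \sum_(i <- I) `|x i|.
Proof.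
rewrite /= invr1 powRr1; first by apply: eq_bigr => i _; rewrite powRr1.
by apply: sumr_ge0 => i _; exact: powR_ge0.
Qed.

(** Extension by zero brings sums over different finite sets to one index list. *)
Lemma big_fset_sub (M : nmodType) (s : seq nat) (I : {fset nat}) (x : nat -> M) :
  uniq s -> {subset I <= s} ->
  \sum_(i <- s) (if i \in I then x i else 0) = \sum_(i <- I) x i.
Proof.
move=> us Is; rewrite -big_mkcond -big_filter; apply/perm_big/uniq_perm.
- exact: filter_uniq.
- exact: fset_uniq.
- by move=> i; rewrite mem_filter andb_idr//; exact: Is.
Qed.

(** A triangle inequality shaped for adding two decompositions with different index sets. *)
Lemma lq_norm_fsetU (q : \bar R) (I J : {fset nat}) (x y z : nat -> R) :
  q = 1%:E \/ q = +oo%E ->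
  (forall i, `|z i| <= (if i \in I then `|x i| else 0)
                       + (if i \in J then `|y i| else 0)) ->
  lq_norm q (I `|` J)%fset z <= lq_norm q I x + lq_norm q J y.
Proof.
move=> [] -> zxy.
  have sI : {subset I <= (I `|` J)%fset} by move=> i iI; rewrite inE iI.
  have sJ : {subset J <= (I `|` J)%fset} by move=> i iJ; rewrite inE iJ orbT.
  have uIJ := fset_uniq (I `|` J)%fset.
  rewrite !lq_norm1 -(big_fset_sub _ _ I (fun i => `|x i|) uIJ sI).
  rewrite -(big_fset_sub _ _ J (fun i => `|y i|) uIJ sJ).
  by rewrite -big_split; apply: ler_sum.
have max0 K (f : nat -> R) : 0 <= \big[Num.max/0]_(i <- K) `|f i|.
  by elim/big_rec : _ => // i r _ r0; rewrite le_max r0 orbT.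
rewrite /=; apply: bigmax_le => [|i _]; first by rewrite addr_ge0.
apply: le_trans (zxy i) _; apply: lerD; case: ifPn => // iI.
  exact: (@bigmax_sup_seq _ _ _ _ _ i).
exact: (@bigmax_sup_seq _ _ _ _ _ i).
Qed.

End SumsOverFsets.

(** * The approximation norm on the span *)

Section SpanNorm.
Context {R : realType} {k : scalar_kind}.
Variable V : hilbertType R k.
Variables (W : nat -> hilbertType R k) (Rop : forall i, {linear W i -> V}).
Variables (gamma : nat -> R) (q : \bar R).
Hypothesis q1oo : q = 1%:E \/ q = +oo%E.

Local Notation wnorm := (fun i w => (gamma i)^-1 * fnorm (hdot (W i)) w).
Local Notation span := (split_span Rop (wsupp gamma)).
Local Notation nu := (span_norm Rop gamma q).

Lemma lq_norm_ge0 I (x : nat -> R) : 0 <= lq_norm q I x.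
Proof.
case: q => [p| |] //=; first exact: powR_ge0.
by elim/big_rec : _ => // i r _ r0; rewrite le_max r0 orbT.
Qed.

Lemma span_norm_le v I w : decomposition Rop (wsupp gamma) v I w ->
  nu v <= lq_norm q I (fun i => wnorm i (w i)).
Proof.
move=> vIw; apply: ge_inf; last by exists I, w.
by exists 0 => _ [I' [w' [_ ->]]]; exact: lq_norm_ge0.
Qed.

(** Membership in the span makes the set under the infimum nonempty; on the empty set [inf] would be
    0. Division by S leaves S = 0 as a separate case. *)
Lemma le_mul_span_norm v (y S : R) : 0 <= S -> span v ->
  (forall I w, decomposition Rop (wsupp gamma) v I w ->
    y <= S * lq_norm q I (fun i => wnorm i (w i))) -> y <= S * nu v.
Proof.
move=> S0 [I0 [w0 v0]] yS.
have [S00|Sn] := eqVneq S 0.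
  by have := yS _ _ v0; rewrite S00 !mul0r.
have Sp : 0 < S by rewrite lt_def Sn.
rewrite -ler_pdivrMl//; apply: lb_le_inf; first by eexists; exists I0, w0.
by move=> _ [I [w [vIw ->]]]; rewrite ler_pdivrMl// yS.
Qed.

(** The families are total functions with arbitrary values off their index sets, hence the cut to
    zero. *)
Lemma decompositionD x y I w J w' :
  decomposition Rop (wsupp gamma) x I w -> decomposition Rop (wsupp gamma) y J w' ->
  decomposition Rop (wsupp gamma) (x + y) (I `|` J)%fset
    (fun i => (if i \in I then w i else 0) + (if i \in J then w' i else 0)).
Proof.
move=> [Isupp ->] [Jsupp ->]; split.
  by move=> i; rewrite inE => /orP[/Isupp|/Jsupp].
have ext (L : {fset nat}) (w0 : forall i, W i) : {subset L <= (I `|` J)%fset} ->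
    \sum_(i <- L) Rop i (w0 i) =
    \sum_(i <- (I `|` J)%fset) Rop i (if i \in L then w0 i else 0).
  move=> LIJ; rewrite -(big_fset_sub _ (I `|` J)%fset) ?fset_uniq//.
  by apply: eq_bigr => i _; case: ifP => //; rewrite linear0.
rewrite (ext I w) ?(ext J w') -?big_split => [|i iJ|i iI].
- by apply: eq_bigr => i _; rewrite linearD.
- by rewrite inE iJ orbT.
- by rewrite inE iI.
Qed.

Lemma decompositionN x I w : decomposition Rop (wsupp gamma) x I w ->
  decomposition Rop (wsupp gamma) (- x) I (fun i => - w i).
Proof.
move=> [Isupp ->]; split=> //.
by rewrite -sumrN; apply: eq_bigr => i _; rewrite linearN.
Qed.

Lemma split_spanB x y : span x -> span y -> span (x - y).
Proof.
move=> [I [w xw]] [J [w' yw]].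
exact: (ex_intro _ _ (ex_intro _ _ (decompositionD _ _ _ _ _ _ xw (decompositionN _ _ _ yw)))).
Qed.

(** Adding any decomposition of x to any of y bounds the left side; the two infima are then taken
    one after the other. *)
Lemma span_normD x y : span x -> span y -> nu (x + y) <= nu x + nu y.
Proof.
move=> sx sy.
suff H I w J w' : decomposition Rop (wsupp gamma) x I w ->
    decomposition Rop (wsupp gamma) y J w' ->
    nu (x + y) <= lq_norm q I (fun i => wnorm i (w i))
                  + lq_norm q J (fun i => wnorm i (w' i)).
  rewrite -lerBlDr -[nu x]mul1r; apply: le_mul_span_norm => // I w xIw.
  rewrite mul1r lerBlDl -lerBlDr -[nu y]mul1r.
  apply: le_mul_span_norm => // J w' yJw'.
  by rewrite mul1r lerBlDl H.
move=> xIw yJw'; apply: le_trans (span_norm_le _ _ _ (decompositionD _ _ _ _ _ _ xIw yJw')) _.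
apply: lq_norm_fsetU => // i; rewrite !normrM.
have c0 : forall b (z : W i), (if b then `|(gamma i)^-1| * `|fnorm (hdot (W i)) z| else 0) =
    `|(gamma i)^-1| * fnorm (hdot (W i)) (if b then z else 0).
  by move=> [] z; rewrite ?(fnorm0 (hdot (W i))) ?mulr0// (ger0_norm (fnorm_ge0 _ _)).
rewrite !c0 -mulrDr ler_wpM2l// (ger0_norm (fnorm_ge0 _ _)) fnormD//.
exact: hdot_sqnorm_ge0.
Qed.

End SpanNorm.

(** * Duality bounds carried from the span to its completion *)

Section CompletionBound.
Context {R : realType} {k : scalar_kind}.
Variables (V : hilbertType R k) (a : {hermitian V for false & scalar_conj R k}).
Variables (W : nat -> hilbertType R k) (Rop : forall i, {linear W i -> V}).
Variables (gamma : nat -> R) (q : \bar R).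
Hypothesis q1oo : q = 1%:E \/ q = +oo%E.
Hypothesis a_continuous : continuous (fun p : V * V => a p.1 p.2).
Hypothesis a_coercive : coercive a.
Variables (S : V -> R) (L : R).
Hypothesis S_le : forall v, S v <= L * fnorm a v.
Local Notation span := (split_span Rop (wsupp gamma)).
Local Notation nu := (span_norm Rop gamma q).
Hypothesis S_dual : forall e v, span v -> reform a e v <= S e * nu v.

Lemma coercive_re : exists2 c : R, 0 < c &
  forall v, c * sqnorm (hdot V) v <= sqnorm a v.
Proof.
have [c c0 ca] := a_coercive; exists (scalar_re c).
  by rewrite -(scalar_re0 R k) scalar_re_lt.
move=> v; rewrite /sqnorm -scalar_re_ofM scalar_of_re ?(ltW c0)// -hdot_normE.
exact: scalar_re_le.
Qed.

Lemma coercive_sqnorm_ge0 v : 0 <= sqnorm a v.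
Proof.
have [c c0 /(_ v)] := coercive_re; apply: le_trans.
by rewrite mulr_ge0 ?(ltW c0)//; exact: hdot_sqnorm_ge0.
Qed.

Lemma coercive_definite v : a v v = 0 -> v = 0.
Proof.
move=> av; have [c c0 /(_ v)] := a_coercive.
rewrite av pmulr_rle0// => v0; apply/eqP; rewrite -normr_eq0 -sqrf_eq0.
by rewrite eq_le v0 exprn_ge0.
Qed.

Lemma span_norm_ge0 v : 0 <= nu v.
Proof.
have [[x xv]|none] := pselect (exists x, exists I w,
    decomposition Rop (wsupp gamma) v I w /\
    x = lq_norm q I (fun i => (gamma i)^-1 * fnorm (hdot (W i)) (w i))).
  apply: lb_le_inf; first by exists x.
  by move=> _ [I [w [_ ->]]]; exact: lq_norm_ge0.
rewrite /span_norm (_ : [set _ | _] = set0) ?inf0//.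
by rewrite -subset0 => x xv; apply: none; exists x.
Qed.

(** Duality at e = v gives |v|^2 <= L |v| [nu v], and one factor |v| cancels. So the inclusion of
    the span into V_a is continuous. *)
Lemma fnorm_le_span_norm v : span v -> fnorm a v <= `|L| * nu v.
Proof.
move=> sv; have [->|v0] := eqVneq (fnorm a v) 0.
  by rewrite mulr_ge0 ?span_norm_ge0.
have vp : 0 < fnorm a v by rewrite lt_def v0 fnorm_ge0.
rewrite -(ler_pM2r vp) -expr2 sqr_fnorm; last exact: coercive_sqnorm_ge0.
apply: le_trans (S_dual v v sv) _; rewrite mulrAC ler_wpM2r ?span_norm_ge0//.
by apply: le_trans (S_le v) _; rewrite ler_wpM2r ?fnorm_ge0// ler_norm.
Qed.

(** Continuity of [a] at the origin turns convergence in V into convergence in the energy norm. *)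
Lemma hdot_fnorm_cvg0 (s : nat -> V) :
  (forall e : R, 0 < e -> \forall n \near \oo, fnorm (hdot V) (s n) < e) ->
  fnorm a (s n) @[n --> \oo] --> (0 : R).
Proof.
move=> s0.
have cs : s n @[n --> \oo] --> (0 : V).
  apply/cvgrPdist_lt => e e0.
  have re0 : 0 < scalar_re e by rewrite -(scalar_re0 R k) scalar_re_lt.
  have := s0 _ re0; apply: filterS => n.
  by rewrite sub0r normrN -{2}(scalar_of_re R k e (ltW e0)) hdot_fnorm_lt.
have cp : (s n, s n) @[n --> \oo] --> ((0, 0) : V * V) by exact: cvg_pair.
have ca : a (s n) (s n) @[n --> \oo] --> (0 : scalar_field R k).
  rewrite -(linear0r a 0).
  exact: (cvg_comp _ (fun p : V * V => a p.1 p.2) cp (a_continuous (0, 0))).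
apply/cvgrPdist_lt => e e0.
have e2 : 0 < scalar_of R k (e ^+ 2) by rewrite scalar_of_gt0 ?exprn_gt0.
have /cvgrPdist_lt/(_ _ e2) := ca; apply: filterS => n.
rewrite !sub0r !normrN (ger0_norm (fnorm_ge0 _ _)) => /scalar_re_lt.
rewrite scalar_ofK => h.
rewrite -(ltr_pXn2r (n := 2)) ?nnegrE ?fnorm_ge0 ?(ltW e0)//.
rewrite sqr_fnorm; last exact: coercive_sqnorm_ge0.
exact: le_lt_trans (scalar_re_le_norm _ _ _) h.
Qed.

Variable h : completion Rop gamma q.

(** The sequence is Cauchy in the energy norm, hence in V by coercivity. Its limit in V is also the
    limit in the energy norm, so [xget] does not fall back on its default. *)
Lemma completion_valP : fnorm a (h n - completion_val a h) @[n --> \oo] --> (0 : R).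
Proof.
suff [l hl] : exists l : V, fnorm a (h n - l) @[n --> \oo] --> (0 : R).
  rewrite /completion_val; case: xgetP => [x _ //|none].
  by have := none l; case.
have [c c0 ca] := coercive_re.
have hC e : 0 < e -> exists N, forall m n, (N <= m)%N -> (N <= n)%N ->
    fnorm (hdot V) (h m - h n) < e.
  move=> e0.
  (* The square root of c compares the two norms; the added 1 covers L = 0. *)
  have d0 : 0 < Num.sqrt c * e / (`|L| + 1).
    by rewrite divr_gt0 ?mulr_gt0 ?sqrtr_gt0 ?ltr_wpDl.
  have [N NP] := cseq_cauchy h d0; exists N => m n Nm Nn.
  have {NP}lt1 := NP m n Nm Nn.
  have le1 := fnorm_le_span_norm _ (split_spanB _ _ _ _ _ _ (cseq_span h m) (cseq_span h n)).
  have sc0 : 0 < Num.sqrt c by rewrite sqrtr_gt0.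
  rewrite -(ltr_pM2l sc0).
  have le2 : Num.sqrt c * fnorm (hdot V) (h m - h n) <= fnorm a (h m - h n).
    rewrite -sqrtrM ?(ltW c0)// ler_sqrt//; exact: coercive_sqnorm_ge0.
  apply: le_lt_trans le2 _; apply: le_lt_trans le1 _.
  move: lt1; rewrite ltr_pdivlMr ?ltr_wpDl//; apply: le_lt_trans.
  by rewrite mulrC ler_wpM2l ?span_norm_ge0// lerDl.
have [l hl] := hilbert_complete _ _ hC; exists l.
exact: hdot_fnorm_cvg0.
Qed.

(** By the reverse triangle inequality the norms form a real Cauchy sequence, so the [lim] in the
    definition is a true limit. *)
Lemma completion_normP : nu (h n) @[n --> \oo] --> completion_norm h.
Proof.
suff : cvg (nu (h n) @[n --> \oo]) by [].
apply/cauchy_cvgP/cauchy_ballP => e e0.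
have [N NP] := cseq_cauchy h e0.
pose A := (nu \o h) @` [set n | (N <= n)%N].
exists (A, A) => /=; first by split; exists N => // n Nn; exists n.
move=> [_ _] /= [[m Nm <-] [n Nn <-]].
have nuB x y : span x -> span y -> nu x - nu y <= nu (x - y).
  move=> sx sy; rewrite lerBlDr -{1}(subrK y x); apply: span_normD => //.
  exact: split_spanB.
rewrite -ball_normE /ball_ /= ltr_norml ltrNl opprB.
by rewrite !(le_lt_trans (nuB _ _ (cseq_span h _) (cseq_span h _)))// NP.
Qed.

Lemma completion_norm_ge0 : 0 <= completion_norm h.
Proof.
apply: limr_ge; first by apply/cvg_ex; eexists; exact: completion_normP.
by apply: nearW => n; exact: span_norm_ge0.
Qed.

(** Limit of the bounds for h n, with a(e, h - h n) <= |e| |h - h n| as the vanishing error. [S] is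
    abstract so as to serve both approximation spaces. *)
Lemma reform_completion_le e :
  reform a e (completion_val a h) <= S e * completion_norm h.
Proof.
have c1 : S e * nu (h n) + fnorm a e * fnorm a (h n - completion_val a h)
    @[n --> \oo] --> S e * completion_norm h + fnorm a e * 0.
  by apply: cvgD; apply: cvgMr; [exact: completion_normP|exact: completion_valP].
rewrite -[X in _ <= X]addr0 -(mulr0 (fnorm a e)) -(cvg_lim _ c1)//.
apply: limr_ge; first by apply/cvg_ex; eexists; exact: c1.
apply: nearW => n.
rewrite -(subrK (h n) (completion_val a h)) reformDr addrC lerD//.
  exact: S_dual (cseq_span h n).
by rewrite subrK fnormBC; apply: reform_le; exact: coercive_sqnorm_ge0.
Qed.

End CompletionBound.

(** * A supersolution of the error recursion *)

Section ErrorRecursion.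
Variable R : realType.
Implicit Types D C : R.

Definition error_bound D C (m : nat) : R := D + Num.sqrt C / Num.sqrt m.+1%:R.

Lemma error_bound_ge0 D C m : 0 <= D -> 0 <= error_bound D C m.
Proof. by move=> D0; rewrite addr_ge0// divr_ge0// sqrtr_ge0. Qed.

Lemma error_bound_step D C m : 0 <= D -> 0 <= C ->
  m.+1%:R ^+ 2 * error_bound D C m ^+ 2 + 2 * m.+1%:R * D * error_bound D C m + C
    <= m.+2%:R ^+ 2 * error_bound D C m.+1 ^+ 2.
Proof.
move=> D0 C0; rewrite /error_bound.
have c0 : 0 <= Num.sqrt C by rewrite sqrtr_ge0.
rewrite -{3}(sqr_sqrtr C0); move: (Num.sqrt C) c0 => c c0.
have x0 : 0 < Num.sqrt (m.+1%:R : R) by rewrite sqrtr_gt0 ltr0n.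
have y0 : 0 < Num.sqrt (m.+2%:R : R) by rewrite sqrtr_gt0 ltr0n.
have xE : m.+1%:R = Num.sqrt m.+1%:R ^+ 2 :> R by rewrite sqr_sqrtr ?ler0n.
have yE : m.+2%:R = Num.sqrt m.+2%:R ^+ 2 :> R by rewrite sqr_sqrtr ?ler0n.
have xy : Num.sqrt m.+2%:R ^+ 2 = Num.sqrt m.+1%:R ^+ 2 + 1 :> R.
  by rewrite -xE -yE natr1.
have ley : Num.sqrt m.+1%:R <= Num.sqrt m.+2%:R :> R.
  by rewrite ler_sqrt ?ler0n// ler_nat.
rewrite {1 3}xE {1}yE.
move: (Num.sqrt m.+1%:R) (Num.sqrt m.+2%:R) x0 y0 xy ley => x y x0 y0 xy ley {xE yE}.
have xn : x != 0 by rewrite gt_eqF.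
have yn : y != 0 by rewrite gt_eqF.
have -> : (x ^+ 2) ^+ 2 * (D + c / x) ^+ 2 + 2 * x ^+ 2 * D * (D + c / x) + c ^+ 2
    = (D * (x ^+ 2 + 1) + c * x) ^+ 2 + c ^+ 2 - D ^+ 2 by field.
have -> : (y ^+ 2) ^+ 2 * (D + c / y) ^+ 2 = (D * y ^+ 2 + c * y) ^+ 2 by field.
rewrite -xy.
have h1 : 0 <= D * y ^+ 2 * c * (y - x) by rewrite ?mulr_ge0 ?subr_ge0 ?sqr_ge0// ltW.
have -> : (D * y ^+ 2 + c * y) ^+ 2 =
  (D * y ^+ 2 + c * x) ^+ 2 + c ^+ 2 * (y ^+ 2 - x ^+ 2) + 2 * (D * y ^+ 2 * c * (y - x)).
  by ring.
have -> : y ^+ 2 - x ^+ 2 = 1 by rewrite xy addrC addKr.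
have := sqr_ge0 D; rewrite mulr1; lra.
Qed.

Lemma error_bound_le D E m : 0 <= D -> 0 <= E ->
  error_bound D (2 * E) m <= 2 * D + Num.sqrt (8 * E) / Num.sqrt m.+1%:R.
Proof.
move=> D0 E0; apply: lerD; first by rewrite ler_peMl// ler1n.
by rewrite ler_wpM2r ?invr_ge0 ?sqrtr_ge0// ler_wsqrtr// ler_wpM2r// ler_nat.
Qed.

Lemma error_bound_cvg D C : error_bound D C m @[m --> \oo] --> D.
Proof.
rewrite -[X in _ --> X]addr0 -(mulr0 (Num.sqrt C)).
apply: cvgD; first exact: cvg_cst.
apply: cvgMr.
apply: (cvg_trans (_ : _ `=>` (Num.sqrt ((n.+1%:R)^-1 : R)) @[n --> \oo])).
  by apply: near_eq_cvg; apply: nearW => n; rewrite sqrtrV ?ler0n.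
rewrite -sqrtr0; apply: (cvg_comp _ _ cvg_harmonic).
exact: sqrt_continuous.
Qed.

End ErrorRecursion.

(** * Functionals of the residual norms dual to the approximation norms *)

Section Duality.
Context {R : realType} {k : scalar_kind}.
Variables (V : hilbertType R k) (a : {hermitian V for false & scalar_conj R k}).
Variables (W : nat -> hilbertType R k) (Rop : forall i, {linear W i -> V}).
Variable Lambda : R.
Hypothesis a_ge0 : forall v, 0 <= sqnorm a v.
Hypothesis Rop_bounded : forall (i : nat) (w : W i),
  fnorm a (Rop i w) <= Lambda * fnorm (hdot (W i)) w.
Local Notation resnorm := (resnorm V a W Rop).

Lemma reform_decomposition_le gamma e v I w :
  decomposition Rop gamma v I w ->
  reform a e v <= \sum_(i <- I) resnorm i e * fnorm (hdot (W i)) (w i).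
Proof.
move=> [_ ->]; rewrite reform_sumr; apply: ler_sum => i _.
exact: reform_Rop_le Rop_bounded _ _ _.
Qed.

(** The supremum runs over squares to match [greedy]; the root is taken outside. *)
Definition max_resnorm (e : V) : R :=
  Num.sqrt (sup (range (fun i => sqnorm (hdot (W i)) (Top a Rop i e)))).

(** Boundedness is what makes the real [sup] a genuine supremum. *)
Lemma resnorm_ubound e : ubound
  (range (fun i => sqnorm (hdot (W i)) (Top a Rop i e))) ((`|Lambda| * fnorm a e) ^+ 2).
Proof.
move=> _ [i _ <-]; rewrite -(sqr_fnorm _ (hdot_sqnorm_ge0 (W i))).
by rewrite ler_pXn2r ?nnegrE ?fnorm_ge0 ?mulr_ge0 ?fnorm_ge0//; exact: resnorm_le.
Qed.

Lemma resnorm_le_max i e : resnorm i e <= max_resnorm e.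
Proof.
apply: ler_wsqrtr; apply: ub_le_sup; last by exists i.
by exists ((`|Lambda| * fnorm a e) ^+ 2); exact: resnorm_ubound.
Qed.

Lemma max_resnorm_le e : max_resnorm e <= `|Lambda| * fnorm a e.
Proof.
rewrite -[leRHS]ger0_norm ?mulr_ge0 ?fnorm_ge0// -sqrtr_sqr; apply: ler_wsqrtr.
by apply: ge_sup (resnorm_ubound e); exists (sqnorm (hdot (W 0)) (Top a Rop 0 e)), 0%N.
Qed.

(** Pairing of l^oo with l^1 in each decomposition of v. *)
Lemma max_resnorm_dual e v : split_span Rop (wsupp (fun=> 1 : R)) v ->
  reform a e v <= max_resnorm e * span_norm Rop (fun=> 1) 1%:E v.
Proof.
move=> sv; apply: le_mul_span_norm => //; first exact: sqrtr_ge0.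
move=> I w vIw; apply: le_trans (reform_decomposition_le _ _ _ _ _ vIw) _.
rewrite lq_norm1 mulr_sumr; apply: ler_sum => i _.
rewrite invr1 mul1r (ger0_norm (fnorm_ge0 _ _)) ler_wpM2r ?fnorm_ge0//.
exact: resnorm_le_max.
Qed.

Section Mean.
Variable p : nat -> R.
Hypothesis p_ge0 : forall i, 0 <= p i.
Hypothesis p_sum : (\sum_(0 <= i <oo) (p i)%:E = 1)%E.

(** The expectation of |T_i e| for an index drawn from [p]. The series is bounded, so [fine] loses
    nothing. *)
Definition mean_resnorm (e : V) : R :=
  fine (\sum_(0 <= i <oo) (p i * resnorm i e)%:E)%E.

Lemma mean_resnorm_term_ge0 i e : 0 <= p i * resnorm i e.
Proof. by rewrite mulr_ge0 ?resnorm_ge0. Qed.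

Lemma mean_resnorm_series_le e :
  (\sum_(0 <= i <oo) (p i * resnorm i e)%:E <= (`|Lambda| * fnorm a e)%:E)%E.
Proof.
rewrite -[leRHS]mule1 -p_sum -nneseriesZl; last by move=> i _; rewrite lee_fin.
apply: lee_nneseries => i _; first by rewrite lee_fin mean_resnorm_term_ge0.
by rewrite -EFinM lee_fin mulrC ler_wpM2r//; exact: resnorm_le.
Qed.

Lemma mean_resnormE e :
  (\sum_(0 <= i <oo) (p i * resnorm i e)%:E)%E = (mean_resnorm e)%:E.
Proof.
rewrite /mean_resnorm fineK// fin_numElt (lt_le_trans _ (nneseries_ge0 _))//=.
  by rewrite (le_lt_trans (mean_resnorm_series_le e))// ltry.
by move=> i _ _; rewrite lee_fin mean_resnorm_term_ge0.
Qed.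

Lemma mean_resnorm_ge0 e : 0 <= mean_resnorm e.
Proof.
rewrite -lee_fin -mean_resnormE; apply: nneseries_ge0 => i _ _.
by rewrite lee_fin mean_resnorm_term_ge0.
Qed.

Lemma mean_resnorm_le e : mean_resnorm e <= `|Lambda| * fnorm a e.
Proof. by rewrite -lee_fin -mean_resnormE mean_resnorm_series_le. Qed.

Lemma sum_resnorm_le_mean e (I : {fset nat}) :
  \sum_(i <- I) p i * resnorm i e <= mean_resnorm e.
Proof.
pose n := (\max_(i <- I) i).+1.
have In : {subset I <= index_iota 0 n}.
  by move=> i iI; rewrite mem_index_iota ltnS leq0n/=; exact: leq_bigmax_seq.
rewrite -(big_fset_sub _ _ _ _ (iota_uniq _ _) In) -lee_fin -mean_resnormE.
apply: le_trans (nneseries_lim_ge n _); last first.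
  by move=> i _ _; rewrite lee_fin mean_resnorm_term_ge0.
rewrite sumEFin lee_fin; apply: ler_sum => i _.
by case: ifP => // _; exact: mean_resnorm_term_ge0.
Qed.

(** With x the weighted maximum norm, |w_i| <= p_i x on the support of [p]; summing against |T_i e|
    yields the mean. *)
Lemma mean_resnorm_dual e v : split_span Rop (wsupp p) v ->
  reform a e v <= mean_resnorm e * span_norm Rop p +oo%E v.
Proof.
move=> sv; apply: le_mul_span_norm => //; first exact: mean_resnorm_ge0.
move=> I w vIw; apply: le_trans (reform_decomposition_le _ _ _ _ _ vIw) _.
set x := lq_norm _ _ _.
have x0 : 0 <= x by exact: lq_norm_ge0.
apply: (@le_trans _ _ (\sum_(i <- I) p i * resnorm i e * x)); last first.
  by rewrite -mulr_suml ler_wpM2r// sum_resnorm_le_mean.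
rewrite !big_seq; apply: ler_sum => i iI.
have pi : 0 < p i by exact: vIw.1.
rewrite mulrAC mulrC ler_wpM2r ?resnorm_ge0//.
rewrite -ler_pdivrMl// -[leLHS]ger0_norm; last by rewrite mulr_ge0 ?invr_ge0 ?fnorm_ge0.
exact: (@bigmax_sup_seq _ _ _ _ _ i).
Qed.

End Mean.
End Duality.

(** * Integrals of functions of variables with values in nat *)

Section DiscreteVariables.
Context {d : measure_display} {T : measurableType d} {R : realType}.
Variable P : probability T R.
Local Open Scope ereal_scope.

Lemma measurable_preimage_nat (Y : T -> nat) (B : set nat) :
  measurable_fun setT Y -> measurable (Y @^-1` B).
Proof. by move=> mY; rewrite -[X in measurable X]setTI; exact: mY. Qed.

(** A preimage is a countable union over the values of [Y], and every set of naturals is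
    measurable. *)
Lemma measurable_fun_nat2 (d' : measure_display) (U : measurableType d')
    (Y Z : T -> nat) (H : nat -> nat -> U) :
  measurable_fun setT Y -> measurable_fun setT Z ->
  measurable_fun setT (fun x => H (Y x) (Z x)).
Proof.
move=> mY mZ _ B _; rewrite setTI.
rewrite (_ : _ @^-1` B =
    \bigcup_n (Y @^-1` [set n] `&` Z @^-1` [set i | B (H n i)])); last first.
  apply/seteqP; split => [x BH|x [n _ [/= <-]]//].
  by exists (Y x).
apply: bigcup_measurable => n _.
by apply: measurableI; exact: measurable_preimage_nat.
Qed.

Lemma measurable_fun_nat1 (d' : measure_display) (U : measurableType d')
    (Y : T -> nat) (H : nat -> U) :
  measurable_fun setT Y -> measurable_fun setT (fun x => H (Y x)).
Proof. by move=> mY; exact: (measurable_fun_nat2 _ _ _ _ (fun n _ => H n) mY mY). Qed.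

Lemma integral_preimage_nat (D : set T) (Y : T -> nat) (f : T -> \bar R) :
  measurable D -> measurable_fun setT Y -> measurable_fun setT f ->
  (forall x, 0 <= f x) ->
  \int[P]_(x in D) f x =
  \sum_(0 <= n <oo) \int[P]_(x in D `&` Y @^-1` [set n]) f x.
Proof.
move=> mD mY mf f0.
have DE : D = \bigcup_n (D `&` Y @^-1` [set n]).
  apply/seteqP; split => [x Dx|x [n _ []]//].
  by exists (Y x).
rewrite {1}DE ge0_integral_bigcup//.
- by move=> n; apply: measurableI => //; exact: measurable_preimage_nat.
- exact: measurable_funS mf.
- exact/trivIset_setIl/trivIset_preimage1.
Qed.

(** A discrete Fubini theorem: the event Y = n is split by the values of [Z], and each piece
    contributes P(Y = n) p_i f(n,i). *)
Lemma integral_indep_nat (Y Z : T -> nat) (p : nat -> R) (f : nat -> nat -> R) :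
  measurable_fun setT Y -> measurable_fun setT Z ->
  (forall n i, P (Y @^-1` [set n] `&` Z @^-1` [set i]) =
               P (Y @^-1` [set n]) * (p i)%:E) ->
  (forall i, (0 <= p i)%R) -> (forall n i, (0 <= f n i)%R) ->
  \int[P]_x (f (Y x) (Z x))%:E =
  \int[P]_x \sum_(0 <= i <oo) (p i * f (Y x) i)%:E.
Proof.
move=> mY mZ YZ p0 f0.
have pf0 n i : 0 <= (p i * f n i)%:E by rewrite lee_fin mulr_ge0.
rewrite (integral_preimage_nat setT Y)//; last 2 first.
  exact: (measurable_fun_nat2 _ _ _ _ (fun n i => (f n i)%:E)).
  by move=> x; rewrite lee_fin.
rewrite [RHS](integral_preimage_nat setT Y)//; last 2 first.
- exact: (measurable_fun_nat1 _ _ _ (fun n => \sum_(0 <= i <oo) (p i * f n i)%:E)).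
- by move=> x; apply: nneseries_ge0.
apply: eq_eseriesr => n _; rewrite setTI.
have mYn : measurable (Y @^-1` [set n]) by exact: measurable_preimage_nat.
transitivity (\int[P]_(x in Y @^-1` [set n])
    cst (\sum_(0 <= i <oo) (p i * f n i)%:E) x); last first.
  by apply: eq_integral => x; rewrite inE /= => ->.
have [r PYn] : exists r, P (Y @^-1` [set n]) = r%:E.
  by exists (fine (P (Y @^-1` [set n]))); rewrite fineK ?fin_num_measure.
rewrite integral_cst// (integral_preimage_nat _ Z)//; last 2 first.
  exact: (measurable_fun_nat2 _ _ _ _ (fun n i => (f n i)%:E)).
  by move=> x; rewrite lee_fin.
rewrite [X in _ = _ * X](_ : _ = r%:E)// muleC -nneseriesZl//.
apply: eq_eseriesr => i _.
transitivity (\int[P]_(x in Y @^-1` [set n] `&` Z @^-1` [set i]) cst (f n i)%:E x).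
  by apply: eq_integral => x; rewrite inE /= => -[-> ->].
rewrite integral_cst; last by apply: measurableI => //; exact: measurable_preimage_nat.
rewrite [X in _ * X = _](_ : _ = r%:E * (p i)%:E); last by rewrite -PYn; exact: YZ.
by rewrite muleCA EFinM (muleC (f n i)%:E).
Qed.

Lemma integral_prob_cst (r : R) : \int[P]_x cst r%:E x = r%:E.
Proof.
rewrite integral_cst//.
exact: etrans (congr1 (mule _) (probability_setT P)) (mule1 _).
Qed.

End DiscreteVariables.

(** * Averaging over the next index with the history fixed *)

Section IndependentIndices.
Context {d : measure_display} {T : measurableType d} {R : realType}.
Variables (P : probability T R) (X : nat -> {RV P >-> nat}) (p : nat -> R).
Hypothesis X_indep : mutually_independent X.
Hypothesis X_distr : forall m i : nat, P (X m @^-1` [set i]) = (p i)%:E.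
Hypothesis p_ge0 : forall i, 0 <= p i.

Definition past (m : nat) (x : T) : seq nat := mkseq (fun j => X j x) m.

(** The history is coded as a natural number, so that the results on nat-valued variables apply to
    it. *)
Lemma measurable_past m : measurable_fun setT (fun x => choice.pickle (past m x)).
Proof.
elim: m => [|m IH]; first exact: measurable_cst.
(* Decodes the history, appends the new index and encodes again; the default is never reached on a
   code. *)
pose H n (i : nat) := choice.pickle (rcons (odflt [::] (choice.unpickle n)) i).
rewrite (_ : (fun x => _) = (fun x => H (choice.pickle (past m x)) (X m x))).
  exact: measurable_fun_nat2.
by apply/funext => x; rewrite /H choice.pickleK /past mkseqS.
Qed.

(** The event is the intersection of the events X_j = s_j, to which independence applies. *)
Lemma prob_prefix (s : seq nat) :
  P [set x | past (size s) x = s] = (\prod_(i <- s) (p i)%:E)%E.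
Proof.
pose J := [fset j in iota 0 (size s)]%fset.
rewrite (_ : [set x | _] =
    \bigcap_(m in [set` J]) (X m @^-1` [set nth 0%N s m])); last first.
  apply/seteqP; split => x /=.
    move=> xs j; rewrite /= inE mem_iota /= add0n => js.
    by rewrite -[in RHS]xs nth_mkseq.
  move=> xs; apply: (@eq_from_nth _ 0%N); first by rewrite size_mkseq.
  rewrite size_mkseq => j js; rewrite nth_mkseq//.
  by apply: xs; rewrite /= inE mem_iota.
rewrite (X_indep J (fun m => [set nth 0%N s m]))//.
under eq_bigr do rewrite X_distr.
rewrite (perm_big (iota 0 (size s))); last first.
  by apply: uniq_perm; rewrite ?fset_uniq ?iota_uniq// => j; rewrite inE.
rewrite -{3}(mkseq_nth 0%N s) big_map.
by [].
Qed.

(** If n codes a list of length m, both sides are given by [prob_prefix]; otherwise both events are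
    empty. *)
Lemma prob_past_next m n i :
  (P ((fun x => choice.pickle (past m x)) @^-1` [set n] `&` X m @^-1` [set i]) =
  P ((fun x => choice.pickle (past m x)) @^-1` [set n]) * (p i)%:E)%E.
Proof.
have [[s sm sn]|none] := pselect (exists2 s : seq nat, size s = m & choice.pickle s = n).
  rewrite (_ : _ @^-1` [set n] = [set x | past (size s) x = s]); last first.
    rewrite sm -sn; apply/seteqP; split => x /=; last by move=> ->.
    exact: (pcan_inj choice.pickleK).
  rewrite prob_prefix (_ : _ `&` _ =
      [set x | past (size (rcons s i)) x = rcons s i]); last first.
    rewrite size_rcons sm; apply/seteqP; split => x /=.
      by move=> [xs xi]; rewrite /past mkseqS -[in RHS]xs -[in RHS]xi.
    rewrite /past mkseqS => /rcons_inj[].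
    by [].
  by rewrite prob_prefix -cats1 big_cat big_seq1.
rewrite (_ : _ @^-1` [set n] = set0) ?set0I ?measure0 ?mul0e//.
rewrite -subset0 => x /= xn; apply: none; exists (past m x) => //.
by rewrite size_mkseq.
Qed.

(** Plays the role of conditioning on the history. *)
Lemma expectation_next (m : nat) (f : seq nat -> nat -> R) :
  (forall s i, 0 <= f s i) ->
  (\int[P]_x (f (past m x) (X m x))%:E =
   \int[P]_x \sum_(0 <= i <oo) (p i * f (past m x) i)%:E)%E.
Proof.
move=> f0; pose g n i := f (odflt [::] (choice.unpickle n)) i.
have gE x i : f (past m x) i = g (choice.pickle (past m x)) i by rewrite /g choice.pickleK.
under eq_integral do rewrite gE.
under [RHS]eq_integral do under eq_eseriesr do rewrite gE.
apply: integral_indep_nat => // [|n i|n i].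
- exact: measurable_past.
- exact: prob_past_next.
- exact: f0.
Qed.

End IndependentIndices.

(** * Error bounds for the iterates *)

Section SchwarzConvergence.
Context {R : realType} {k : scalar_kind}.
Variables (V : hilbertType R k) (a : {hermitian V for false & scalar_conj R k}).
Variables (W : nat -> hilbertType R k) (Rop : forall i, {linear W i -> V}).
Variable Lambda : R.
Hypothesis a_ge0 : forall v, 0 <= sqnorm a v.
Hypothesis a_definite : forall v, a v v = 0 -> v = 0.
Hypothesis Rop_bounded : forall (i : nat) (w : W i),
  fnorm a (Rop i w) <= Lambda * fnorm (hdot (W i)) w.
Local Notation resnorm := (resnorm V a W Rop).
Local Notation max_resnorm := (max_resnorm V a W Rop).
Variables (u h : V).

(** Makes the iterate a function of a finite history. *)
Lemma schwarz_ext idx idx' m : (forall j, (j < m)%N -> idx j = idx' j) ->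
  schwarz a Rop u idx m = schwarz a Rop u idx' m.
Proof.
elim: m => //= m IH ij; rewrite ij// IH// => j jm.
by apply: ij; exact: ltnW.
Qed.

Lemma sqnorm_le_error_bound0 D C : 0 <= D -> 2 * sqnorm a u <= C ->
  sqnorm a (u - 0) <= error_bound R D C 0 ^+ 2.
Proof.
move=> D0 uC; rewrite subr0 /error_bound sqrtr1 divr1.
have C0 : 0 <= C by apply: le_trans uC; rewrite mulr_ge0.
apply: le_trans (_ : C <= _); first by have := a_ge0 u; lra.
rewrite -[leLHS]sqr_sqrtr// ler_pXn2r ?nnegrE ?addr_ge0 ?sqrtr_ge0//.
by rewrite lerDr.
Qed.

(** * Error bound under the greedy choice of indices *)

Section Greedy.
Variables (N beta : R) (idx : nat -> nat).
Hypothesis N_ge0 : 0 <= N.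
Hypothesis beta_gt0 : 0 < beta.
Hypothesis h_dual : forall e, reform a e h <= max_resnorm e * N.
Hypothesis idx_greedy : greedy a Rop u beta idx.
Local Notation D := (fnorm a (u - h)).
Local Notation C := (2 * (sqnorm a u + Lambda ^+ 2 * (N / beta) ^+ 2)).

Lemma greedy_resnorm m : let e := u - schwarz a Rop u idx m in
  beta * max_resnorm e <= resnorm (idx m) e.
Proof.
move=> /=; set e := u - _.
rewrite -[beta]ger0_norm ?(ltW beta_gt0)// -sqrtr_sqr -sqrtrM ?sqr_ge0//.
exact/ler_wsqrtr/idx_greedy.
Qed.

(** [N] stands for the norm of [h], either in the completion, for the estimate, or in the span, for
    the convergence. *)
Lemma greedy_error m :
  fnorm a (u - schwarz a Rop u idx m) <= error_bound R D C m.
Proof.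
have D0 : 0 <= D by exact: fnorm_ge0.
have LN0 : 0 <= Lambda ^+ 2 * (N / beta) ^+ 2 by rewrite mulr_ge0 ?sqr_ge0.
have C0 : 0 <= C by rewrite mulr_ge0 ?addr_ge0.
rewrite -(ler_pXn2r (n := 2)) ?nnegrE ?fnorm_ge0 ?error_bound_ge0// sqr_fnorm//.
elim: m => [|m IH]; first by apply: sqnorm_le_error_bound0 => //; lra.
have m2 : 0 < (m.+2%:R : R) ^+ 2 by rewrite exprn_gt0 ?ltr0n.
rewrite -(ler_pM2l m2).
(* With t = N / beta the greedy choice gives t |T_i e| >= N sup_j |T_j e| >= a(e,h), so only a(e, u
   - h) remains. *)
apply: le_trans (schwarz_step_le _ _ _ _ Lambda a_ge0 a_definite Rop_bounded _ _ _ _ (N / beta)) _.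
set e := u - schwarz _ _ _ _ _ in IH *.
apply: le_trans (error_bound_step _ _ _ _ D0 C0).
rewrite lerD2r; apply: lerD; first by rewrite ler_wpM2l ?sqr_ge0.
rewrite -[leRHS]mulrA ler_wpM2l ?mulr_ge0 ?ler0n//.
have eb : fnorm a e <= error_bound R D C m.
  by rewrite -(ler_pXn2r (n := 2)) ?nnegrE ?fnorm_ge0 ?error_bound_ge0// sqr_fnorm.
apply: (@le_trans _ _ (fnorm a e * D)); last by rewrite mulrC ler_wpM2l.
have -> : reform a e u = reform a e (u - h) + reform a e h by rewrite reformBr subrK.
have e1 := reform_le a a_ge0 e (u - h).
have e2 : reform a e h <= N / beta * resnorm (idx m) e.
  apply: le_trans (h_dual e) _.
  rewrite -mulrA mulrC ler_wpM2l// ler_pdivlMl//; exact: greedy_resnorm.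
lra.
Qed.

End Greedy.

(** * Mean square error bound under random indices *)

Section Random.
Variables (p : nat -> R) (N : R).
Hypothesis p_ge0 : forall i, 0 <= p i.
Hypothesis p_sum : (\sum_(0 <= i <oo) (p i)%:E = 1)%E.
Hypothesis N_ge0 : 0 <= N.
Local Notation mean_resnorm := (mean_resnorm V a W Rop p).
Hypothesis h_dual : forall e, reform a e h <= mean_resnorm e * N.
Variable D : R.
Hypothesis D_gt0 : 0 < D.
Hypothesis D_ge : fnorm a (u - h) <= D.
Local Notation C := (2 * (sqnorm a u + Lambda ^+ 2 * N ^+ 2)).

(* [2 |e| <= |e|^2 / s + s] replaces Jensen's inequality for the square root. *)
Lemma mean_step_le (x : V) (m : nat) (s : R) : 0 < s ->
  (\sum_(0 <= i <oo) (p i * sqnorm a (u - schwarz_step a Rop u m i x))%:E <=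
   ((m.+2%:R ^+ 2)^-1 * ((m.+1%:R ^+ 2 + m.+1%:R * D / s) * sqnorm a (u - x)
     + (m.+1%:R * D * s + C)))%:E)%E.
Proof.
move=> s0; set e := u - x; set Sg := (\sum_(0 <= i <oo) _)%E.
have m1 : 0 < (m.+1%:R : R) by rewrite ltr0n.
have m2 : 0 < (m.+2%:R : R) ^+ 2 by rewrite exprn_gt0 ?ltr0n.
pose K0 := m.+1%:R ^+ 2 * sqnorm a e + 2 * m.+1%:R * reform a e u + C.
have term0 i : 0 <= p i * sqnorm a (u - schwarz_step a Rop u m i x).
  by rewrite mulr_ge0.
have res0 i : 0 <= p i * resnorm i e by rewrite mulr_ge0 ?resnorm_ge0.
have mN0 : 0 <= 2 * m.+1%:R * N by rewrite !mulr_ge0.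
(* The step bound with t = N, averaged over i. The residual term stands on the left so that all
   series have nonnegative terms. *)
have main : ((m.+2%:R ^+ 2)%:E * Sg + (2 * m.+1%:R * N * mean_resnorm e)%:E <= K0%:E)%E.
  rewrite (EFinM _ (mean_resnorm e)) -(mean_resnormE _ _ _ _ Lambda)//.
  rewrite -!nneseriesZl; [|by move=> i _; rewrite lee_fin..].
  rewrite -nneseriesD; last 2 first.
  - by move=> i _ _; rewrite -EFinM lee_fin mulr_ge0// ltW.
  - by move=> i _ _; rewrite -EFinM lee_fin mulr_ge0.
  rewrite -[leRHS]mule1 -p_sum -nneseriesZl; last by move=> i _; rewrite lee_fin.
  apply: lee_nneseries => i _.
    by rewrite -!EFinM -EFinD lee_fin addr_ge0// mulr_ge0// ltW.
  rewrite -!EFinM -EFinD lee_fin.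
  have := schwarz_step_le _ _ _ _ Lambda a_ge0 a_definite Rop_bounded u x m i N.
  rewrite -/e => st.
  rewrite [leLHS](_ : _ = p i * (m.+2%:R ^+ 2 * sqnorm a (u - schwarz_step a Rop u m i x)
     + 2 * m.+1%:R * N * resnorm i e)); last by ring.
  by rewrite [leRHS]mulrC ler_wpM2l// /K0; lra.
rewrite EFinM lee_pdivlMl//.
move: main; rewrite -leeBrDr// => /le_trans; apply.
rewrite -EFinB lee_fin /K0.
have -> : reform a e u = reform a e (u - h) + reform a e h by rewrite reformBr subrK.
have e1 : reform a e (u - h) <= fnorm a e * D.
  by apply: le_trans (reform_le a a_ge0 e (u - h)) _; rewrite ler_wpM2l ?fnorm_ge0.
have e2 : 2 * (fnorm a e * D) <= D / s * sqnorm a e + D * s.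
  rewrite -sqr_fnorm// -subr_ge0.
  have -> : D / s * fnorm a e ^+ 2 + D * s - 2 * (fnorm a e * D) =
    D / s * (fnorm a e - s) ^+ 2 by field; rewrite gt_eqF.
  by rewrite mulr_ge0 ?sqr_ge0// divr_ge0 ?ltW.
(* By duality the mean residual dominates a(e,h), and it cancels below. *)
have e3 : 2 * reform a e u <= 2 * N * mean_resnorm e + D / s * sqnorm a e + D * s.
  by have := h_dual e; rewrite reformBr in e1; lra.
have -> : reform a e (u - h) + reform a e h = reform a e u by rewrite reformBr subrK.
have : m.+1%:R * (2 * reform a e u) <=
   m.+1%:R * (2 * N * mean_resnorm e + D / s * sqnorm a e + D * s).
  by rewrite ler_wpM2l// ltW.
lra.
Qed.

Context {d : measure_display} {Omega : measurableType d}.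
Variables (P : probability Omega R) (X : nat -> {RV P >-> nat}).
Hypothesis X_indep : mutually_independent X.
Hypothesis X_distr : forall m i : nat, P (X m @^-1` [set i]) = (p i)%:E.

Local Notation err2 m x := (sqnorm a (u - schwarz a Rop u (fun n => X n x) m)).

Lemma schwarz_past m x :
  schwarz a Rop u (fun n => X n x) m = schwarz a Rop u (nth 0%N (past P X m x)) m.
Proof. by apply: schwarz_ext => j jm; rewrite nth_mkseq. Qed.

Lemma measurable_fun_past (d' : measure_display) (U : measurableType d')
    (f : seq nat -> U) m : measurable_fun setT (fun x => f (past P X m x)).
Proof.
pose g n := f (odflt [::] (choice.unpickle n)).
rewrite (_ : (fun x => _) = (fun x => g (choice.pickle (past P X m x)))).
  exact/measurable_fun_nat1/measurable_past.
by apply/funext => x; rewrite /g choice.pickleK.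
Qed.

(** Averaging over the next index bounds the new squared error by an affine function of the old one;
    expectations then obey the recursion. *)
Lemma random_error m :
  (\int[P]_x (err2 m x)%:E <= (error_bound R D C m ^+ 2)%:E)%E.
Proof.
have D0 := ltW D_gt0.
have LN0 : 0 <= Lambda ^+ 2 * N ^+ 2 by rewrite mulr_ge0 ?sqr_ge0.
have C0 : 0 <= C by rewrite mulr_ge0 ?addr_ge0.
elim: m => [|m IH].
  apply: le_trans (_ : \int[P]_x (cst (error_bound R D C 0 ^+ 2)%:E x) <= _)%E; last first.
    by rewrite integral_prob_cst.
  apply: ge0_le_integral => //= x _; first by rewrite lee_fin.
  by rewrite lee_fin; apply: sqnorm_le_error_bound0 => //; lra.
(* Since E|e|^2 <= s^2, the terms (D / s) |e|^2 + D s average to at most 2 D s, as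
   [error_bound_step] needs. D > 0 ensures s > 0. *)
pose s := error_bound R D C m.
have s0 : 0 < s by rewrite ltr_pwDl// divr_ge0 ?sqrtr_ge0.
pose f (r : seq nat) i :=
  sqnorm a (u - schwarz_step a Rop u m i (schwarz a Rop u (nth 0%N r) m)).
have -> : (\int[P]_x (err2 m.+1 x)%:E = \int[P]_x (f (past P X m x) (X m x))%:E)%E.
  by apply: eq_integral => x _; rewrite /= /f -schwarz_past.
rewrite (expectation_next P X p)//; last by move=> r i; exact: a_ge0.
have m1 : 0 < (m.+1%:R : R) by rewrite ltr0n.
have m2 : 0 < (m.+2%:R : R) ^+ 2 by rewrite exprn_gt0 ?ltr0n.
pose A := (m.+2%:R ^+ 2)^-1 * (m.+1%:R ^+ 2 + m.+1%:R * D / s).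
pose B := (m.+2%:R ^+ 2)^-1 * (m.+1%:R * D * s + C).
have A0 : 0 <= A.
  rewrite mulr_ge0 ?invr_ge0 ?(ltW m2)// addr_ge0 ?sqr_ge0//.
  by rewrite divr_ge0 ?(ltW s0)// mulr_ge0 ?ler0n.
have B0 : 0 <= B.
  rewrite mulr_ge0 ?invr_ge0 ?(ltW m2)// addr_ge0 ?C0//.
  by rewrite mulr_ge0 ?(ltW s0)// mulr_ge0 ?ler0n.
pose e2 r : R := sqnorm a (u - schwarz a Rop u (nth 0%N r) m).
have me2 : measurable_fun setT (fun x => (e2 (past P X m x))%:E).
  exact: (measurable_fun_past _ _ (fun r => (e2 r)%:E)).
apply: (@le_trans _ _ (\int[P]_x (A%:E * (e2 (past P X m x))%:E + cst B%:E x))%E).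
  apply: ge0_le_integral => //.
  - by move=> x _; apply: nneseries_ge0 => i _ _; rewrite lee_fin mulr_ge0 ?a_ge0.
  - exact: (measurable_fun_past _ _ (fun r => \sum_(0 <= i <oo) (p i * f r i)%:E)%E).
  - exact: (measurable_fun_past _ _ (fun r => A%:E * (e2 r)%:E + B%:E)%E).
  - move=> x _; rewrite /= -EFinM -EFinD.
    rewrite (_ : A * _ + B = (m.+2%:R ^+ 2)^-1 *
      ((m.+1%:R ^+ 2 + m.+1%:R * D / s) * e2 (past P X m x)
       + (m.+1%:R * D * s + C))); last by rewrite /A /B; ring.
    exact: mean_step_le.
have f10 x : setT x -> (0 <= A%:E * (e2 (past P X m x))%:E)%E.
  by move=> _; rewrite -EFinM lee_fin mulr_ge0 ?a_ge0.
have mf1 : measurable_fun setT (fun x => A%:E * (e2 (past P X m x))%:E)%E.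
  exact: (measurable_fun_past _ _ (fun r => A%:E * (e2 r)%:E)%E).
have f20 (x : Omega) : setT x -> (0 <= cst B%:E x)%E by rewrite lee_fin.
rewrite (ge0_integralD P measurableT f10 mf1 f20)//.
rewrite ge0_integralZl//; last by move=> x _; rewrite lee_fin; exact: a_ge0.
rewrite integral_prob_cst.
have -> : (\int[P]_x (e2 (past P X m x))%:E = \int[P]_x (err2 m x)%:E)%E.
  by apply: eq_integral => x _; rewrite /e2 -schwarz_past.
apply: (@le_trans _ _ (A%:E * (s ^+ 2)%:E + B%:E)%E).
  by rewrite leeD2r// lee_wpmul2l// lee_fin.
rewrite -EFinM -EFinD lee_fin -(ler_pM2l m2).
apply: le_trans (error_bound_step _ _ _ m D0 C0); rewrite -/s.
rewrite (_ : _ * (_ + B) = m.+1%:R ^+ 2 * s ^+ 2 + 2 * m.+1%:R * D * s + C)//.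
by rewrite /A /B; field; rewrite !gt_eqF// ltr0n.
Qed.

End Random.
End SchwarzConvergence.

(** * Estimates from duality on the completion, convergence from density of the span *)

Theorem theorem2 (R : realType) (k : scalar_kind)
  (V : hilbertType R k) (V_separable : separable V)
  (a : {hermitian V for false & scalar_conj R k})
  (a_continuous : continuous (fun p : V * V => a p.1 p.2))
  (a_coercive : coercive a)
  (F : {linear V -> scalar_field R k | scalar_conj R k \; *%R})
  (F_bounded : bounded_functional F)
  (W : nat -> hilbertType R k) (Rop : forall i : nat, {linear W i -> V})
  (span_dense : fnorm_dense a (split_span Rop setT))
  (Lambda : R)
  (Rop_bounded : forall (i : nat) (w : W i),
     fnorm a (Rop i w) <= Lambda * fnorm (hdot (W i)) w)
  (u : V) (u_solution : forall v : V, a u v = F v) :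
  (forall (beta : R) (idx : nat -> nat),
     0 < beta <= 1 -> greedy a Rop u beta idx ->
     (fnorm a (u - schwarz a Rop u idx m) @[m --> \oo] --> (0 : R)) /\
     (forall (h : completion Rop (fun=> 1) 1%:E) (m : nat),
        fnorm a (u - schwarz a Rop u idx m)
          <= 2 * fnorm a (u - completion_val a h)
             + Num.sqrt (8 * (fnorm a u ^+ 2
                              + (Lambda / beta) ^+ 2 * completion_norm h ^+ 2))
               / Num.sqrt m.+1%:R))
  /\
  (forall (p : nat -> R) (d : measure_display) (Omega : measurableType d)
      (P : probability Omega R) (X : nat -> {RV P >-> nat}),
     discrete_distribution p ->
     mutually_independent X ->
     (forall m i : nat, P (X m @^-1` [set i]) = (p i)%:E) ->
     let err (m : nat) (x : Omega) : R :=
       fnorm a (u - schwarz a Rop u (fun n => X n x) m) in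
     (forall (h : completion Rop p +oo%E) (m : nat),
        (sqrte 'E_P[fun x => (err m x ^+ 2)%R]
          <= (2 * fnorm a (u - completion_val a h)
              + Num.sqrt (8 * (fnorm a u ^+ 2
                               + Lambda ^+ 2 * completion_norm h ^+ 2))
                / Num.sqrt m.+1%:R)%R%:E)%E) /\
     ((forall i : nat, 0 < p i) ->
      ('E_P[fun x => (err m x ^+ 2)%R])%E @[m --> \oo] --> (0 : \bar R)%E)).
Proof.
move=> {V_separable F_bounded u_solution F}.
have a_ge0 := coercive_sqnorm_ge0 V a a_coercive.
have a_def := coercive_definite V a a_coercive.
(* For the convergence claims [h] is replaced by a span element within e / 2 of u; the bound tends
   to e / 2, whatever the norm of that element. *)
have small_error (e C : R) : 0 < e ->
    \forall m \near \oo, error_bound R (e / 2) C m < e.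
  move=> e0; have lt_e : e / 2 < e by lra.
  exact: (cvgr_lt _ (error_bound_cvg R (e / 2) C)).
split=> [beta idx /andP[beta0 _] idx_greedy|p d Omega P X [p_ge0 p_sum] X_indep X_distr err].
  split=> [|h m].
    apply/cvgrPdist_lt => e e0.
    have e2 : 0 < e / 2 by rewrite divr_gt0.
    have [w [I [v [_ wv]]] uw] := span_dense u _ e2.
    have sw : split_span Rop (wsupp (fun=> 1 : R)) w.
      by exists I, v; split=> // i _; exact: ltr01.
    set N := span_norm Rop (fun=> 1 : R) 1%:E w.
    have N0 : 0 <= N by exact: span_norm_ge0.
    have dual e' : reform a e' w <= max_resnorm V a W Rop e' * N.
      exact: (max_resnorm_dual _ _ _ _ Lambda).
    have := small_error e (2 * (sqnorm a u + Lambda ^+ 2 * (N / beta) ^+ 2)) e0.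
    apply: filterS => m; apply: le_lt_trans.
    rewrite sub0r normrN (ger0_norm (fnorm_ge0 _ _)).
    apply: le_trans (greedy_error _ _ _ _ _ a_ge0 a_def Rop_bounded _ _ _ _ _ N0 beta0 dual idx_greedy m) _.
    by rewrite lerD2r ltW.
  have q1 : (1 : R)%:E = 1%:E \/ (1 : R)%:E = +oo%E by left.
  have N0 := completion_norm_ge0 _ _ _ _ _ q1 h.
  have dual e : reform a e (completion_val a h) <=
      max_resnorm V a W Rop e * completion_norm h.
    apply: (reform_completion_le _ _ _ _ _ _ q1 a_continuous a_coercive _ `|Lambda|).
    - exact: max_resnorm_le.
    - exact: (max_resnorm_dual _ _ _ _ Lambda).
  apply: le_trans (greedy_error _ _ _ _ _ a_ge0 a_def Rop_bounded _ _ _ _ _ N0 beta0 dual idx_greedy m) _.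
  rewrite sqr_fnorm// (_ : (Lambda / beta) ^+ 2 * _ =
    Lambda ^+ 2 * (completion_norm h / beta) ^+ 2); last by rewrite -!exprMn mulrAC mulrA.
  by apply: error_bound_le; rewrite ?fnorm_ge0// addr_ge0// mulr_ge0 ?sqr_ge0.
have EE m : ('E_P[fun x => (err m x ^+ 2)%R] = \int[P]_x
    (sqnorm a (u - schwarz a Rop u (fun n => X n x) m))%:E)%E.
  by rewrite unlock; apply: eq_integral => x _; rewrite /err sqr_fnorm.
split=> [h m|p_gt0].
  have qoo : (+oo : \bar R)%E = 1%:E \/ (+oo : \bar R)%E = +oo%E by right.
  have N0 := completion_norm_ge0 _ _ _ _ _ qoo h.
  have dual e : reform a e (completion_val a h) <=
      mean_resnorm V a W Rop p e * completion_norm h.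
    apply: (reform_completion_le _ _ _ _ _ _ qoo a_continuous a_coercive _ `|Lambda|).
    - exact: mean_resnorm_le.
    - exact: (mean_resnorm_dual _ _ _ _ Lambda).
  set D := fnorm a (u - _).
  have D0 : 0 <= D by exact: fnorm_ge0.
  (* D may vanish while [random_error] requires a positive value, so D + e / 2 is used; doubling it
     costs exactly e. *)
  apply/lee_addgt0Pr => e e0; rewrite -EFinD.
  have De0 : 0 < D + e / 2 by rewrite ltr_wpDl// divr_gt0.
  have De : D <= D + e / 2 by rewrite lerDl ltW// divr_gt0.
  have bound := random_error _ _ _ _ _ a_ge0 a_def Rop_bounded _ _ _ _ p_ge0 p_sum N0 dual _ De0 De P X X_indep X_distr m.
  rewrite EE; apply: le_trans (_ : sqrte (_ ^+ 2)%:E <= _)%E.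
    by rewrite lee_sqrt; [exact: bound|rewrite lee_fin sqr_ge0].
  rewrite EFin_expe sqrte_sqr abse_EFin lee_fin ger0_norm ?error_bound_ge0 ?(ltW De0)//.
  apply: le_trans (error_bound_le _ _ _ _ (ltW De0) _) _.
    by rewrite addr_ge0// mulr_ge0 ?sqr_ge0.
  by rewrite sqr_fnorm//; lra.
under eq_fun do rewrite EE.
have bounded e : 0 < e -> exists C : R, forall m, (\int[P]_x
    (sqnorm a (u - schwarz a Rop u (fun n => X n x) m))%:E <=
    (error_bound R (e / 2) C m ^+ 2)%:E)%E.
  move=> e0; have e2 : 0 < e / 2 by rewrite divr_gt0.
  have [w [I [v [_ wv]]] uw] := span_dense u _ e2.
  (* Positive weights make every index admissible, so the dense span is the span over the
     support. *)
  have sw : split_span Rop (wsupp p) w by exists I, v; split=> // i _; exact: p_gt0.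
  set N := span_norm Rop p +oo%E w.
  have N0 : 0 <= N by exact: span_norm_ge0.
  have dual e' : reform a e' w <= mean_resnorm V a W Rop p e' * N.
    exact: (mean_resnorm_dual _ _ _ _ Lambda).
  exists (2 * (sqnorm a u + Lambda ^+ 2 * N ^+ 2)) => m.
  exact: (random_error _ _ _ _ _ a_ge0 a_def Rop_bounded _ w _ _ p_ge0 p_sum N0 dual _ e2 (ltW uw) P X X_indep X_distr m).
have int0 m : (0 <= \int[P]_x
    (sqnorm a (u - schwarz a Rop u (fun n => X n x) m))%:E)%E.
  by apply: integral_ge0 => x _; rewrite lee_fin.
have fin m : (\int[P]_x
    (sqnorm a (u - schwarz a Rop u (fun n => X n x) m))%:E)%E \is a fin_num.
  have [C /(_ m) le_bound] := bounded 1 ltr01.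
  by rewrite ge0_fin_numE// (le_lt_trans le_bound) ?ltry.
(* The expectations are finite, so convergence is checked in the reals. *)
apply: cvg_EFin; first exact: nearW.
apply/cvgrPdist_lt => e e0.
(* The quantity is a squared error, hence the tolerance sqrt e for its root. *)
have se0 : 0 < Num.sqrt e by rewrite sqrtr_gt0.
have [C le_bound] := bounded _ se0.
have := small_error _ C se0; apply: filterS => m lt_e.
rewrite /= sub0r normrN ger0_norm ?fine_ge0// -lte_fin fineK//.
apply: le_lt_trans (le_bound m) _; rewrite lte_fin -[ltRHS]sqr_sqrtr ?(ltW e0)//.
by rewrite ltr_pXn2r ?nnegrE ?error_bound_ge0 ?(ltW se0)// divr_ge0 ?(ltW se0).
Qed.
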